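(* Let $N\ge 3$ and let $\Omega\subset\mathbb{R}^N$ be a bounded domain with $n$ different points $a_1,\dots,a_n\in\Omega$, $n\ge2$. Put $V_*(x):=\sum_{i=1}^n\frac{1}{|x-a_i|^2}$ and $$\mu_\Omega:=\inf_{u\in D^{1,2}(\Omega),\,u\ne0}\frac{\int_\Omega|\nabla u|^2\,dx}{\int_\Omega V_*|u|^2\,dx}.$$ Then $$\frac{(N-2)^2}{4n}<\mu_\Omega\le\frac{(N-2)^2}{4}.$$
   Context: $D^{1,2}(\Omega)$ is the completion of $C_0^\infty(\Omega)$ with respect to the norm $\left(\int_\Omega|\nabla u|^2\,dx\right)^{1/2}$; for bounded $\Omega$ it coincides with $H_0^1(\Omega)$. *)

(* Defs.v *)
From HB Require Import structures.
From mathcomp Require Import all_boot all_order all_algebra.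
From mathcomp Require Import all_classical all_reals all_analysis.

Set Implicit Arguments.
Unset Strict Implicit.
Unset Printing Implicit Defensive.

Import Order.TTheory GRing.Theory Num.Theory.
Import numFieldNormedType.Exports.

Local Open Scope classical_set_scope.
Local Open Scope ring_scope.

(* Euclidean space R^N is 'rV[R]_N.  The library's norm `|x| on 'rV[R]_N is the
   sup norm: it gives the usual topology and bounded sets, while the Euclidean
   norm is enorm below. *)

Definition measure_rV_display : measure_display.
Proof. exact: default_measure_display. Qed.

Section measurable_rV.
Variables (R : realType) (n : nat).

Definition rV_coord (i : 'I_n) (v : 'rV[R]_n) : measurableTypeR R := v ord0 i.

Let rV_set0 : g_sigma_preimage rV_coord set0.
Proof. exact: sigma_algebra0. Qed.

Let rV_setC A : g_sigma_preimage rV_coord A -> g_sigma_preimage rV_coord (~` A).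
Proof. exact: sigma_algebraC. Qed.

Let rV_bigcup (F : (set 'rV[R]_n)^nat) :
  (forall i, g_sigma_preimage rV_coord (F i)) ->
  g_sigma_preimage rV_coord (\bigcup_i F i).
Proof. exact: sigma_algebra_bigcup. Qed.

(* The sigma-algebra generated by the coordinates, i.e. the Borel one. *)
HB.instance Definition _ := @isMeasurable.Build measure_rV_display
  'rV[R]_n (g_sigma_preimage rV_coord) rV_set0 rV_setC rV_bigcup.

End measurable_rV.

Section lebesgue_rV.
Variable R : realType.

Lemma measurable_rV_coord n (i : 'I_n) :
  measurable_fun [set: 'rV[R]_n] (@rV_coord R n i).
Proof.
move=> _ Y mY; rewrite setTI; apply: sub_sigma_algebra => /=.
rewrite -bigcup_seq/=; exists i => /=; first by rewrite mem_index_enum.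
by exists Y => //; rewrite setTI.
Qed.

Lemma measurable_fun_rV d (T : measurableType d) n (f : T -> 'rV[R]_n) :
  (forall i, measurable_fun [set: T] (@rV_coord R n i \o f)) ->
  measurable_fun [set: T] f.
Proof.
move=> mf _ A mA; rewrite setTI.
have sub : g_sigma_preimage (fun i => @rV_coord R n i \o f) `<=` measurable.
  apply: smallest_sub; first exact: sigma_algebra_measurable.
  rewrite -bigcup_seq/=; apply: bigcup_sub => i _ /= _ [B mB <-]; exact: mf.
apply: sub; rewrite g_sigma_preimage_comp.
by exists A => //; rewrite setTI.
Qed.

Definition rV_cons n (p : measurableTypeR R * 'rV[R]_n) : 'rV[R]_n.+1 :=
  \row_i (if unlift ord0 i is Some j then p.2 ord0 j else p.1).

Definition rV_uncons n (v : 'rV[R]_n.+1) : measurableTypeR R * 'rV[R]_n :=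
  (v ord0 ord0, \row_i v ord0 (lift ord0 i)).

Lemma rV_cons0 n p : @rV_cons n p ord0 ord0 = p.1.
Proof. by rewrite mxE unlift_none. Qed.

Lemma rV_consS n p i : @rV_cons n p ord0 (lift ord0 i) = p.2 ord0 i.
Proof. by rewrite mxE liftK. Qed.

Lemma rV_consK n : cancel (@rV_cons n) (@rV_uncons n).
Proof.
move=> [x v]; rewrite /rV_uncons rV_cons0; congr (_, _).
by apply/rowP => i; rewrite mxE rV_consS.
Qed.

Lemma rV_unconsK n : cancel (@rV_uncons n) (@rV_cons n).
Proof.
move=> v; apply/rowP => i.
case: (unliftP ord0 i) => [j ->|->]; last by rewrite rV_cons0.
by rewrite rV_consS mxE.
Qed.

Lemma measurable_rV_cons n : measurable_fun setT (@rV_cons n).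
Proof.
apply: measurable_fun_rV => i.
case: (unliftP ord0 i) => [j ->|->].
  rewrite [X in measurable_fun _ X](_ : _ = (@rV_coord R n j) \o snd).
    by apply: measurableT_comp => //; exact: measurable_rV_coord.
  by apply/funext => p; exact: rV_consS.
rewrite [X in measurable_fun _ X](_ : _ = fst) //.
by apply/funext => p; exact: rV_cons0.
Qed.

Lemma measurable_rV_uncons n : measurable_fun setT (@rV_uncons n).
Proof.
apply/measurable_fun_pairP; split; first exact: (measurable_rV_coord ord0).
apply: measurable_fun_rV => i.
rewrite [X in measurable_fun _ X](_ : _ = @rV_coord R n.+1 (lift ord0 i)).
  exact: measurable_rV_coord.
by apply/funext => v /=; rewrite /rV_coord mxE.
Qed.

Section lebesgue_rVS.
Local Open Scope ereal_scope.
Variables (n : nat) (m : {sigma_finite_measure set 'rV[R]_n -> \bar R}).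

Definition lebesgue_rVS : set 'rV[R]_n.+1 -> \bar R :=
  pushforward (lebesgue_measure \x m) (@rV_cons n).

Let lebesgue_rVS0 : lebesgue_rVS set0 = 0.
Proof. by rewrite /lebesgue_rVS /pushforward preimage_set0 measure0. Qed.

Let lebesgue_rVS_ge0 A : 0 <= lebesgue_rVS A.
Proof. by rewrite /lebesgue_rVS /pushforward; apply: measure_ge0. Qed.

Let lebesgue_rVS_sigma_additive : semi_sigma_additive lebesgue_rVS.
Proof.
have mc A : measurable A -> measurable (@rV_cons n @^-1` A).
  by move=> mA; rewrite -[X in measurable X]setTI; exact: measurable_rV_cons.
move=> F mF tF mUF; rewrite /lebesgue_rVS /pushforward preimage_bigcup.
apply: measure_semi_sigma_additive.
- by move=> k; exact: mc.
- apply/trivIsetP => /= i j _ _ ij; rewrite -preimage_setI.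
  by move/trivIsetP : tF => /(_ _ _ _ _ ij) ->//; rewrite preimage_set0.
- by rewrite -preimage_bigcup; exact: mc.
Qed.

HB.instance Definition _ := isMeasure.Build _ _ _ lebesgue_rVS
  lebesgue_rVS0 lebesgue_rVS_ge0 lebesgue_rVS_sigma_additive.

Let lebesgue_rVS_sigma_finite : sigma_finite setT lebesgue_rVS.
Proof.
have /sigma_finiteP[F [TF ndF Foo]] := sigma_finiteT (@lebesgue_measure R).
have /sigma_finiteP[G [TG ndG Goo]] := sigma_finiteT m.
exists (fun k => @rV_uncons n @^-1` (F k `*` G k)).
  rewrite -preimage_bigcup; apply/esym/seteqP; split => // v _.
  have [i _ Fi] : (\bigcup_i F i) (rV_uncons v).1 by rewrite -TF.
  have [j _ Gj] : (\bigcup_i G i) (rV_uncons v).2 by rewrite -TG.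
  exists (maxn i j) => //; split.
    by move: Fi; exact/subsetPset/ndF/leq_maxl.
  by move: Gj; exact/subsetPset/ndG/leq_maxr.
move=> k; have [mF Fk] := Foo k; have [mG Gk] := Goo k; split.
  rewrite -[X in measurable X]setTI.
  by apply: measurable_rV_uncons => //; exact: measurableX.
rewrite /lebesgue_rVS /pushforward -comp_preimage.
rewrite (_ : _ @^-1` _ = F k `*` G k); last first.
  by rewrite (_ : _ \o _ = id)//; apply/funext => p /=; exact: rV_consK.
by rewrite product_measure1E// lte_mul_pinfty// ge0_fin_numE.
Qed.

HB.instance Definition _ := Measure_isSigmaFinite.Build _ _ _ lebesgue_rVS
  lebesgue_rVS_sigma_finite.

End lebesgue_rVS.

(* Lebesgue measure on R^n: the unit mass on R^0, and the product of the
   one-dimensional Lebesgue measure with that of R^n on R^(n+1). *)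
Fixpoint lebesgue_rV n : {sigma_finite_measure set 'rV[R]_n -> \bar R} :=
  match n with
  | 0 => [the sigma_finite_measure _ _ of \d_(0 : 'rV[R]_0)]
  | n'.+1 => [the sigma_finite_measure _ _ of lebesgue_rVS (lebesgue_rV n')]
  end.

Lemma lebesgue_rV_box n (A : 'I_n -> set (measurableTypeR R)) :
  (forall i, measurable (A i)) ->
  lebesgue_rV n [set v | forall i, A i (v ord0 i)] =
    (\prod_(i < n) lebesgue_measure (A i))%E.
Proof.
elim: n A => [|n IH] A mA.
  by rewrite big_ord0 /= diracE mem_set// => -[].
rewrite big_ord_recl/= /lebesgue_rVS /pushforward.
set B := [set v : 'rV[R]_n | forall i, A (lift ord0 i) (v ord0 i)].
rewrite [X in product_measure1 _ _ X](_ : _ = A ord0 `*` B); last first.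
  apply/seteqP; split=> -[x v] /= h.
    split; first by have := h ord0; rewrite rV_cons0.
    by move=> i; have := h (lift ord0 i); rewrite rV_consS.
  by move=> i; case: (unliftP ord0 i) => [j ->|->];
    [rewrite rV_consS; exact: h.2|rewrite rV_cons0; exact: h.1].
have mB : measurable B.
  rewrite (_ : B = \bigcap_(i in [set: 'I_n])
      (@rV_coord R n i @^-1` A (lift ord0 i))); last first.
    by apply/seteqP; split=> v h; [move=> i _|move=> i]; exact: h.
  apply: fin_bigcap_measurable => // i _.
  by rewrite -[X in measurable X]setTI; exact: measurable_rV_coord.
rewrite product_measure1E//; congr (_ * _)%E.
by apply: (IH (fun i => A (lift ord0 i))) => i; exact: mA.
Qed.

End lebesgue_rV.

Section euclidean.
Variables (R : realType) (N : nat).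
Implicit Types (x : 'rV[R]_N) (f u : 'rV[R]_N -> R) (g : 'rV[R]_N -> 'rV[R]_N).
Implicit Types Omega : set 'rV[R]_N.

Definition enorm x : R := Num.sqrt (\sum_i x ord0 i ^+ 2).

Definition partial (i : 'I_N) f : 'rV[R]_N -> R := 'D_(delta_mx ord0 i) f.

Definition grad f : 'rV[R]_N -> 'rV[R]_N := fun x => \row_i partial i f x.

(* C^oo: the iterated partial derivatives of all orders exist and are
   continuous. *)
Definition smooth f := forall s : seq 'I_N,
  continuous (foldr partial f s) /\
  forall i x, derivable (foldr partial f s) x (delta_mx ord0 i).

Definition test_function Omega f :=
  [/\ smooth f, compact (closure [set x | f x != 0]) &
      closure [set x | f x != 0] `<=` Omega].

Definition dirichlet Omega g : \bar R :=
  (\int[lebesgue_rV R N]_(x in Omega) (enorm (g x) ^+ 2)%:E)%E.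

(* D12 Omega u g: u belongs to D^{1,2}(Omega) and has gradient g.  For bounded
   Omega the completion of the test functions in the Dirichlet norm is
   H^1_0(Omega), whose elements u are the L^2(Omega)-limits of test functions
   phi_k with (grad phi_k) convergent in L^2(Omega); g is the limit of the
   gradients, i.e. the weak gradient of u, hence determined a.e. by u.
   As in L^2, u and g are measurable representatives and only their values in
   Omega matter. *)
Definition D12 Omega u g :=
  [/\ measurable_fun Omega u, measurable_fun Omega g &
    exists phi : nat -> 'rV[R]_N -> R,
    [/\ forall k, test_function Omega (phi k),
        (\int[lebesgue_rV R N]_(x in Omega) (`|phi k x - u x| ^+ 2)%:E)%E
          @[k --> \oo] --> 0%E &
        dirichlet Omega (fun x => grad (phi k) x - g x) @[k --> \oo] --> 0%E]].

(* At x = a i the i-th term is 0 (the inverse of 0), on a null set only. *)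
Definition Vstar n (a : 'I_n -> 'rV[R]_N) x : R :=
  \sum_(i < n) (enorm (x - a i) ^+ 2)^-1.

(* u <> 0 in D^{1,2}(Omega) means that u is not a.e. zero.  The quotients are
   taken in \bar R, so a divergent denominator would give the quotient 0. *)
Definition hardy_mu n (a : 'I_n -> 'rV[R]_N) Omega : \bar R :=
  ereal_inf [set q | exists u g,
    [/\ D12 Omega u g,
        ~ (u = cst 0 %[ae lebesgue_rV R N in Omega]) &
        q = (dirichlet Omega g /
             \int[lebesgue_rV R N]_(x in Omega)
               (Vstar a x * `|u x| ^+ 2)%:E)%E]].

End euclidean.

(* Main.v *)
Require Import Defs.
From mathcomp Require Import all_boot all_order all_algebra.
From mathcomp Require Import all_classical all_reals all_analysis.
From mathcomp Require Import measurable_realfun ring lra.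

Set Implicit Arguments.
Unset Strict Implicit.
Unset Printing Implicit Defensive.

Import Order.TTheory GRing.Theory Num.Theory.
Import numFieldNormedType.Exports.

Local Open Scope classical_set_scope.
Local Open Scope ring_scope.

(** The lower bound comes from a vector field.  For a field F that is C^1 and
    a test function phi, expanding |grad phi + phi F|^2 >= 0 and integrating
    the divergence of phi^2 F to zero gives
      int |grad phi|^2 >= int (div F - |F|^2) phi^2      (hardy_vector_field).
    Take F = alpha \sum_j (x - a_j) p_j with p_j = 1 / (|x - a_j|^2 + e) and
    alpha = (N - 2) / (2 n).  Then div F >= alpha (N - 2) \sum_j p_j, and the
    identity 2 <y, z> = |y|^2 + |z|^2 - |y - z|^2 yields
      |F|^2 <= alpha^2 (n \sum_j p_j
                          - 1/2 \sum_(j, k) |a_j - a_k|^2 p_j p_k).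
    Dropping the double sum would give the constant (N - 2)^2 / (4 n).  But on
    a bounded set every p_k is bounded below, and each pole has another one at
    positive distance, so the double sum dominates a positive multiple of
    \sum_j p_j: the constant exceeds (N - 2)^2 / (4 n) by an amount that does
    not depend on e (polar_field_div, polar_field_sqr, hardy_multipolar_test).
    Since e > 0 removes the singularities, the field is smooth everywhere and
    the weight is bounded, hence the inequality extends to D^{1,2} by density
    (weighted_hardy_D12); monotone convergence as e -> 0 restores V_*
    (hardy_multipolar_D12).

    The upper bound uses one pole a only.  The virtual minimizer of the
    one-pole Hardy inequality is |x - a|^(- (N - 2) / 2); with b = (N - 2) / 4,
    s = |x - a|^2 and a smooth cutoff theta, its approximations
    u_e = (s + e)^(- b) theta (rho - s) are test functions.  With the kernel
    K_e = s ((s + e)^(- b - 1) theta (rho - s))^2 one has V_* u_e^2 >= K_e and,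
    for every d > 0, |grad u_e|^2 <= (4 b^2 + d) K_e + B with B independent of
    e (trial_dirichlet_pointwise).  As |x|^(- N) is not integrable at the
    origin, the integral of K_e tends to infinity when e -> 0
    (integral_trial_kernel_unbounded), so that B disappears from the quotient
    and 4 b^2 = (N - 2)^2 / 4 is approached. *)

(** * Borel measurability of continuous functions on R^N *)

(** An open set is the union of the boxes with rational corners that it
    contains, and there are countably many of those. *)
Lemma open_measurable_rV (R : realType) n (A : set 'rV[R]_n) :
  open A -> measurable A.
Proof.
move=> oA.
pose box (p : 'rV[rat]_n * 'rV[rat]_n) : set 'rV[R]_n :=
  \bigcap_(i in [set: 'I_n]) (@rV_coord R n i @^-1`
     [set` `]ratr (p.1 ord0 i), ratr (p.2 ord0 i)[]).
have mbox p : measurable (box p).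
  apply: fin_bigcap_measurable => // i _.
  by rewrite -[X in measurable X]setTI; apply: measurable_rV_coord => //.
rewrite (_ : A = \bigcup_p (if pselect (box p `<=` A) is left _ then box p
   else set0)); last first.
  apply/seteqP; split => [x Ax|x [p _]]; last first.
    by case: pselect => // + bx; exact.
  have /nbhs_ballP[e /= e0 eA] : nbhs x A by exact: open_nbhs_nbhs.
  have lo i : exists q : rat, ratr q \in `](x ord0 i - e), (x ord0 i)[.
    by apply: rat_in_itvoo; rewrite ltrBlDr ltrDl.
  have hi i : exists q : rat, ratr q \in `](x ord0 i), (x ord0 i + e)[.
    by apply: rat_in_itvoo; rewrite ltrDl.
  pose p := (\row_i xchoose (lo i), \row_i xchoose (hi i)).
  exists p => //; case: pselect => [_|]; last first.
    case => y byx; apply: eA; split => // i j; rewrite ord1.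
    have := byx j I; rewrite /box /p /= !mxE in_itv /= /rV_coord => /andP[].
    have := xchooseP (lo j); have := xchooseP (hi j).
    rewrite !in_itv /= => /andP[h1 h2] /andP[h3 h4] h5 h6.
    by rewrite /ball /= ltr_norml; lra.
  move=> i _; rewrite /p /= in_itv/= !mxE /rV_coord.
  have := xchooseP (lo i); have := xchooseP (hi i).
  by rewrite !in_itv /= => /andP[h1 h2] /andP[h3 h4]; rewrite h1 h4.
apply: countable_bigcupT_measurable => // p.
by case: pselect => // _; exact: measurable0.
Qed.

Lemma continuous_measurable_rV (R : realType) n (f : 'rV[R]_n -> R) :
  continuous f -> measurable_fun setT f.
Proof.
move=> /continuousP cf; apply: (measurability _ (RGenOpens.measurableE R)).
by move=> _ [_ [a [b ->] <-]]; rewrite setTI; apply: open_measurable_rV;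
  apply: cf; exact: interval_open.
Qed.

(** * Integrals of continuous functions vanishing outside a cube *)

(** Cubes are used in place of balls because they split as products along
    the recursive definition of the Lebesgue measure. *)
Definition cbox (R : realType) n (M : R) : set 'rV[R]_n :=
  [set v | forall i, v ord0 i \in `[- M, M]].

Section box.
Variables (R : realType) (n : nat).
Implicit Types (M : R) (f : 'rV[R]_n -> R).

Lemma compact_cbox M : compact (@cbox R n M).
Proof.
by apply: (@rV_compact _ _ (fun=> `[- M, M]%classic)) => _;
  exact: segment_compact.
Qed.

Lemma closed_cbox M : closed (@cbox R n M).
Proof. by apply: compact_closed (@compact_cbox M); exact: norm_hausdorff. Qed.

Lemma measurable_cbox M : measurable (@cbox R n M).
Proof.
rewrite -[cbox M]setCK; apply: measurableC; apply: open_measurable_rV.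
exact/closed_openC/closed_cbox.
Qed.

Lemma lebesgue_cbox_lty M : (lebesgue_rV R n (cbox M) < +oo)%E.
Proof.
rewrite (@lebesgue_rV_box R n (fun=> `[- M, M]%classic))// ltey_eq.
apply/orP; left; elim/big_ind : _ => [//|x y|i _]; first exact: fin_numM.
by rewrite /= lebesgue_measure_itv /=; case: ifP.
Qed.

Lemma integrable_continuous_cbox M f : continuous f ->
  (forall x, ~ cbox M x -> f x = 0) ->
  (lebesgue_rV R n).-integrable setT (EFin \o f).
Proof.
move=> cf f0.
have -> : EFin \o f = (EFin \o f) \_ (cbox M).
  apply/funext => x; rewrite patchE; case: ifPn => //= /negP xM.
  by rewrite f0// => xM'; apply: xM; rewrite inE.
apply/integrable_restrict => //; first exact: measurable_cbox.
rewrite setTI; apply: measurable_bounded_integrable.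
- exact: measurable_cbox.
- exact: lebesgue_cbox_lty.
- by apply: measurable_funTS; exact: continuous_measurable_rV.
- have /compact_bounded[K [_ HK]] := continuous_compact
    (continuous_subspaceT cf) (@compact_cbox M).
  exists K; split; first by rewrite num_real.
  by move=> k Kk x xM; apply: (HK k Kk); exists x.
Qed.

(** A function that vanishes off a closed set is locally zero there. *)
Lemma partial_out_closed (K : set 'rV[R]_n) i f : closed K ->
  (forall x, ~ K x -> f x = 0) -> forall x, ~ K x -> partial i f x = 0.
Proof.
move=> cK f0 x Kx; rewrite /partial.
have nx : nbhs x (~` K) by apply: open_nbhs_nbhs; split => //;
  exact: closed_openC.
rewrite (@near_eq_derive _ _ _ _ (cst 0)) ?derive_cst//.
by apply: filterS nx => y /f0.
Qed.
End box.

(** * Derivatives along lines *)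

Section directional.
Variable R : realType.

(** If L maps the line through a in direction w onto the line through L a in
    direction v, with the same parameter, then the difference quotients of
    f \o L at a and of f at L a coincide.  The slices of a function of several
    variables, the chain rule and the coordinate functions are instances. *)
Lemma derive_affine (U V W : normedModType R) (L : U -> V) (f : V -> W) a w v :
  (forall h : R, L (h *: w + a) = h *: v + L a) ->
  ('D_w (f \o L) a = 'D_v f (L a)) /\
  (derivable (f \o L) a w <-> derivable f (L a) v).
Proof.
move=> HL; rewrite /derive /derivable.
suff -> : (fun h : R =>
    h^-1 *: (((f \o L) \o shift a) (h *: w) - (f \o L) a)) =
  (fun h : R => h^-1 *: ((f \o shift (L a)) (h *: v) - f (L a))) by [].
by apply/funext => h /=; rewrite HL.
Qed.

Lemma is_derive_affine (U V W : normedModType R)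
    (L : U -> V) (f : V -> W) a w v df :
  (forall h : R, L (h *: w + a) = h *: v + L a) ->
  is_derive (L a) v f df <-> is_derive a w (f \o L) df.
Proof.
move=> /derive_affine -/(_ _ f) [E1 E2]; split=> -[H1 H2]; split.
- exact/E2.
- by rewrite E1.
- exact/E2.
- by rewrite -E1.
Qed.

(** The inner function need only have a derivative in the direction v: restrict
    it to the line and apply the chain rule of one variable. *)
Lemma is_derive_chain (V : normedModType R)
    (g : V -> R) (h : R -> R) x v dg dh :
  is_derive x v g dg -> is_derive (g x) 1 h dh ->
  is_derive x v (h \o g) (dh * dg).
Proof.
move=> Hg Hh; pose L (t : R) := t *: v + x.
have HL (t : R) : L (t *: 1 + 0) = t *: v + L 0.
  by rewrite /L scale0r add0r addr0 [t *: _]mulr1.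
have L0 : L 0 = x by rewrite /L scale0r add0r.
rewrite -L0 in Hg Hh *.
apply/(is_derive_affine _ _ HL).
by apply: (@is_derive1_comp _ h (g \o L)); apply/(is_derive_affine _ _ HL).
Qed.
End directional.

(** * The integral of a partial derivative *)

Section slices.
Variables (R : realType) (n : nat).

Lemma rV_cons_lift_line (x : R) (v : 'rV[R]_n) j (h : R) :
  rV_cons (x, h *: delta_mx ord0 j + v) =
  h *: delta_mx ord0 (lift ord0 j) + rV_cons (x, v).
Proof.
apply/rowP => i; rewrite !mxE.
case: (unliftP ord0 i) => [k ->|->] /=.
  by rewrite !mxE (inj_eq (@lift_inj _ _)).
by rewrite mulr0 add0r.
Qed.

Lemma rV_cons_ord0_line (x : R) (v : 'rV[R]_n) (h : R) :
  rV_cons (h *: 1 + x, v) =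
  h *: delta_mx ord0 ord0 + rV_cons (x, v).
Proof.
apply/rowP => i; rewrite !mxE.
case: (unliftP ord0 i) => [k ->|->] /=.
  by rewrite mulr0 add0r.
by [].
Qed.

Lemma cbox_rV_cons M (x : R) (v : 'rV[R]_n) :
  cbox M (rV_cons (x, v)) <-> (x \in `[- M, M] /\ cbox M v).
Proof.
split=> [H|[H1 H2] i].
  split; first by have := H ord0; rewrite rV_cons0.
  by move=> i; have := H (lift ord0 i); rewrite rV_consS.
by case: (unliftP ord0 i) => [k ->|->]; rewrite ?rV_consS ?rV_cons0.
Qed.

Lemma continuous_rV_cons2 (x : R) :
  continuous (fun v : 'rV[R]_n => rV_cons (x, v)).
Proof.
move=> v s /nbhs_ballP[e /= e0 es].
apply/nbhs_ballP; exists e => //= w [_ vw]; apply: es; split => // i j.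
rewrite !mxE; case: (unlift ord0 j) => [k|] /=; last exact: ballxx.
exact: vw.
Qed.

Lemma continuous_rV_cons1 (v : 'rV[R]_n) :
  continuous (fun x : R => rV_cons (x, v)).
Proof.
move=> x s /nbhs_ballP[e /= e0 es].
apply/nbhs_ballP; exists e => //= y xy; apply: es; split => // i j.
rewrite !mxE; case: (unlift ord0 j) => [k|] //=; exact: ballxx.
Qed.
End slices.

(** The fundamental theorem of calculus on an interval whose end points lie
    outside the support. *)
Lemma integral_derive_compact (R : realType) (g : R -> R) M :
  (forall x, derivable g x 1) -> continuous (fun x => 'D_1 g x) ->
  (forall x : R, x \notin `[- M, M] -> g x = 0) ->
  (\int[lebesgue_measure]_x ('D_1 g x)%:E = 0)%E.
Proof.
move=> dg cg g0.
(* The margin makes g vanish at the end points, and keeps the interval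
   nondegenerate when M is not positive. *)
pose K : R := `|M| + 1.
have MK : M < K by rewrite /K; have := ler_norm M; lra.
have gK (x : R) : x \notin `]-K, K[ -> g x = 0.
  move=> h; apply: g0; apply: contra h; rewrite !in_itv /=; lra.
have dg0 (x : R) : x \notin `[-K, K] -> 'D_1 g x = 0.
  move=> xK.
  have nx : nbhs x (~` `[- K, K]%classic).
    apply: open_nbhs_nbhs; split; last exact/negP.
    by apply: closed_openC; exact: interval_closed.
  rewrite (@near_eq_derive _ _ _ _ (cst 0)) ?derive_cst//.
  apply: filterS nx => y /negP yK; rewrite gK//.
  apply: contra yK; exact: subset_itv_oo_cc.
transitivity (\int[lebesgue_measure]_(x in `[(- K)%R, K]) ('D_1 g x)%:E)%E.
  rewrite [RHS]integral_mkcond; apply: eq_integral => x _.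
  rewrite patchE; case: ifPn => // /negP h.
  by rewrite dg0//; apply/negP => h'; apply: h; rewrite inE.
have cgg : continuous g.
  by move=> x; apply: differentiable_continuous; apply/derivable1_diffP.
rewrite (@continuous_FTC2 _ _ g).
- rewrite !gK ?subee//; rewrite in_itv /=; lra.
- rewrite /K; have := normr_ge0 M; lra.
- exact: continuous_subspaceT.
- split.
  + by move=> x _.
  + exact/cvg_at_right_filter/cgg.
  + exact/cvg_at_left_filter/cgg.
- by move=> x _; rewrite derive1E.
Qed.

(** Induction on the dimension, splitting off the first coordinate by Fubini:
    if i is the first coordinate, the inner integral is that of the derivative
    of a compactly supported function of one variable; otherwise fix the first
    coordinate and use the induction hypothesis on the slice. *)
Lemma integral_partial0 (R : realType) n i (G : 'rV[R]_n -> R) M :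
  (forall x, derivable G x (delta_mx ord0 i)) ->
  continuous (partial i G) -> (forall x, ~ cbox M x -> G x = 0) ->
  (\int[lebesgue_rV R n]_x (partial i G x)%:E = 0)%E.
Proof.
elim: n i G => [[]//|n IH] i G dG cG G0.
have pG0 := partial_out_closed i (@closed_cbox R n.+1 M) G0.
have iG := integrable_continuous_cbox cG pG0.
have mG := measurable_int _ iG.
have mc := @measurable_rV_cons R n.
have iGc : (lebesgue_measure \x lebesgue_rV R n)%E.-integrable setT
    ((EFin \o partial i G) \o @rV_cons R n).
  apply/integrableP; split; first exact: (measurableT_comp mG mc).
  have /integrableP[_] := iG.
  rewrite /= ge0_integral_pushforward//.
  rewrite -[X in measurable_fun _ X]/(abse \o (EFin \o partial i G)).
  by apply: measurableT_comp => //; exact: mG.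
rewrite /= /lebesgue_rVS integral_pushforward//.
case: (unliftP ord0 i) => [j ij|i0].
  rewrite -integral12_prod_meas1//.
  apply: integral0_eq => x _; rewrite /fubini_F /= ij.
  have HD (v : 'rV[R]_n) := @derive_affine R 'rV[R]_n 'rV[R]_n.+1 R
    (fun v => rV_cons (x, v)) G v _ _ (rV_cons_lift_line x v j).
  under eq_integral => v _.
    have <- : partial j (G \o (fun v => rV_cons (x, v))) v =
      partial (lift ord0 j) G (rV_cons (x, v)).
      by have [] := HD v.
    over.
  apply: IH.
  - move=> v; have [_ [_ Hd]] := HD v.
    by apply: Hd; rewrite -ij.
  - rewrite (_ : partial _ _ = partial i G \o (fun v => rV_cons (x, v))).
      by move=> v; apply: continuous_comp;
        [exact: continuous_rV_cons2|exact: cG].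
    apply/funext => v; rewrite ij.
    by have [] := HD v.
  - move=> v vM; apply: G0 => /cbox_rV_cons[_]; exact: vM.
rewrite -integral21_prod_meas1//.
apply: integral0_eq => v _; rewrite /fubini_G /= i0.
have HD (x : R) := @derive_affine R R 'rV[R]_n.+1 R
  (fun x => rV_cons (x, v)) G x _ _ (rV_cons_ord0_line x v).
under eq_integral => x _.
  have <- : 'D_1 (G \o (fun x => rV_cons (x, v))) x =
    partial ord0 G (rV_cons (x, v)).
    by have [] := HD x.
  over.
apply: (@integral_derive_compact _ _ M).
- move=> x; have [_ [_ Hd]] := HD x.
  by apply: Hd; rewrite -i0.
- rewrite (_ : (fun x => _) = partial i G \o (fun x => rV_cons (x, v))).
    by move=> x; apply: continuous_comp;
      [exact: continuous_rV_cons1|exact: cG].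
  apply/funext => x; rewrite i0.
  by have [] := HD x.
- move=> x xM; apply: G0 => /cbox_rV_cons[xM' _]; by move/negP : xM.
Qed.

(** * Calculus of real-valued functions *)

Section real_functions.
Variables (R : realType) (V : normedModType R).
Implicit Types f g : V -> R.

Lemma continuous_mulf f g : continuous f -> continuous g ->
  continuous (fun x => f x * g x).
Proof. by move=> cf cg x; apply: cvgM; [exact: cf|exact: cg]. Qed.

Lemma continuous_addf f g : continuous f -> continuous g ->
  continuous (fun x => f x + g x).
Proof. by move=> cf cg x; apply: cvgD; [exact: cf|exact: cg]. Qed.

Lemma continuous_oppf f : continuous f -> continuous (fun x => - f x).
Proof. by move=> cf x; apply: cvgN; exact: cf. Qed.

Lemma continuous_sumf n (f : 'I_n -> V -> R) : (forall i, continuous (f i)) ->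
  continuous (fun x => \sum_(i < n) f i x).
Proof.
by move=> cf x; apply: cvg_big => [|i _]; [exact: add_continuous|exact: cf].
Qed.

Lemma is_derive_mulf f g x v df dg :
  is_derive x v f df -> is_derive x v g dg ->
  is_derive x v (fun y => f y * g y) (f x * dg + g x * df).
Proof. by move=> Hf Hg; exact: is_deriveM. Qed.

Lemma is_derive_addf f g x v df dg :
  is_derive x v f df -> is_derive x v g dg ->
  is_derive x v (fun y => f y + g y) (df + dg).
Proof. by move=> Hf Hg; exact: is_deriveD. Qed.

Lemma is_derive_sumf n (f : 'I_n -> V -> R) x v df :
  (forall i, is_derive x v (f i) (df i)) ->
  is_derive x v (fun y => \sum_(i < n) f i y) (\sum_(i < n) df i).
Proof.
move=> Hf; rewrite (_ : (fun y => _) = \sum_(i < n) f i);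
  first exact: is_derive_sum.
by apply/funext => y; rewrite fct_sumE.
Qed.

End real_functions.

(** * Test functions and the Hardy inequality of a vector field *)

Lemma enorm_sqr (R : realType) N (x : 'rV[R]_N) :
  enorm x ^+ 2 = \sum_i x ord0 i ^+ 2.
Proof. by rewrite sqr_sqrtr// sumr_ge0// => i _; exact: sqr_ge0. Qed.

Lemma enorm_grad_sqr (R : realType) N (f : 'rV[R]_N -> R) x :
  enorm (grad f x) ^+ 2 = \sum_i partial i f x ^+ 2.
Proof. by rewrite enorm_sqr; apply: eq_bigr => i _; rewrite mxE. Qed.

Lemma bounded_sub_cbox (R : realType) N (A : set 'rV[R]_N) :
  bounded_set A -> exists M, A `<=` cbox M.
Proof.
move=> [M [_ HM]]; exists (M + 1) => x Ax i.
have : `|x| <= M + 1 by apply: HM => //; rewrite ltrDl.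
rewrite in_itv /= -ler_norml; apply: le_trans.
rewrite -[leRHS]/(mx_norm x) mx_normrE.
exact: (le_bigmax _ (fun j : 'I_1 * 'I_N => `|x j.1 j.2|) (ord0, i)).
Qed.

Section test_functions.
Variables (R : realType) (N : nat) (Om : set 'rV[R]_N) (f : 'rV[R]_N -> R).
Hypothesis tf : test_function Om f.

Lemma test_continuous : continuous f.
Proof. by have [/(_ [::])[]] := tf. Qed.

Lemma test_derivable x i : derivable f x (delta_mx ord0 i).
Proof. by have [/(_ [::])[_ /(_ i x)]] := tf. Qed.

Lemma test_is_derive x i : is_derive x (delta_mx ord0 i) f (partial i f x).
Proof. exact/derivableP/test_derivable. Qed.

Lemma test_continuous_partial i : continuous (partial i f).
Proof. by have [/(_ [:: i])[]] := tf. Qed.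

Lemma test_out x : ~ Om x -> f x = 0.
Proof.
move=> nx; have [_ _ sub] := tf; apply/eqP/negPn/negP => fx.
by apply: nx; apply: sub; apply: subset_closure.
Qed.

Lemma test_partial_out x i : ~ Om x -> partial i f x = 0.
Proof.
have [_ _ sub] := tf => nx.
apply: (@partial_out_closed R N (closure [set x | f x != 0])).
- exact: closed_closure.
- move=> y ny; apply/eqP/negPn/negP => fy.
  by apply: ny; exact: subset_closure.
- by move=> /sub.
Qed.

End test_functions.

(** |grad phi|^2 + div (phi^2 F) equals
    |grad phi + phi F|^2 + phi^2 (div F - |F|^2), and the divergence
    integrates to zero.  Off Om, both phi and its gradient vanish. *)
Lemma hardy_vector_field (R : realType) N (Om : set 'rV[R]_N)
    (phi w : 'rV[R]_N -> R) (F : 'I_N -> 'rV[R]_N -> R) :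
  open Om -> bounded_set Om -> test_function Om phi ->
  (forall i, continuous (F i)) ->
  (forall i x, derivable (F i) x (delta_mx ord0 i)) ->
  (forall i, continuous (partial i (F i))) ->
  continuous w -> (forall x, 0 <= w x) ->
  (forall x, Om x -> w x <= \sum_i (partial i (F i) x - F i x ^+ 2)) ->
  (\int[lebesgue_rV R N]_(x in Om) (w x * `|phi x| ^+ 2)%:E <=
   dirichlet Om (grad phi))%E.
Proof.
move=> oOm bOm tphi cF dF cdF cw w0 wle.
have [M OmM] := bounded_sub_cbox bOm.
have mOm := open_measurable_rV oOm.
pose G i x := phi x * phi x * F i x.
pose dG i x := phi x * phi x * partial i (F i) x +
  F i x * (phi x * partial i phi x + phi x * partial i phi x).
have GE i x : is_derive x (delta_mx ord0 i) (G i) (dG i x).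
  apply: is_derive_mulf; last exact/derivableP/dF.
  by apply: is_derive_mulf; exact: (test_is_derive tphi).
have partialG i : partial i (G i) = dG i.
  by apply/funext => x; rewrite /partial; exact: derive_val.
have cphi := test_continuous tphi.
have cpphi i := test_continuous_partial tphi (i := i).
have cdG i : continuous (dG i).
  apply: continuous_addf; apply: continuous_mulf => //.
    exact: continuous_mulf.
  by apply: continuous_addf; apply: continuous_mulf.
have cP : continuous (fun x => \sum_i partial i phi x ^+ 2).
  by apply: continuous_sumf => i; exact: continuous_mulf.
have outM x : ~ cbox M x -> ~ Om x by move=> h /OmM.
have dG0 i x : ~ Om x -> dG i x = 0.
  by move=> nx; rewrite /dG (test_out tphi nx) !mul0r addr0 mulr0 addr0.
have P0 x : ~ Om x -> \sum_i partial i phi x ^+ 2 = 0.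
  move=> nx; apply: big1 => i _.
  by rewrite (test_partial_out tphi)// expr0n.
have iP : (lebesgue_rV R N).-integrable setT
    (EFin \o (fun x => \sum_i partial i phi x ^+ 2)).
  by apply: (integrable_continuous_cbox cP) => x /outM /P0.
have idG i : (lebesgue_rV R N).-integrable setT (EFin \o dG i).
  by apply: (integrable_continuous_cbox (cdG i)) => x /outM /dG0; apply.
have intG i : (\int[lebesgue_rV R N]_x (dG i x)%:E = 0)%E.
  rewrite -partialG; apply: (@integral_partial0 _ _ _ _ M).
  - by move=> x; have [] := GE i x.
  - by rewrite partialG.
  - by move=> x /outM nx; rewrite /G (test_out tphi nx) !mul0r.
pose S x := \sum_i partial i phi x ^+ 2 + \sum_i dG i x.
have cS : continuous S by apply: continuous_addf => //; exact: continuous_sumf.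
have S0 x : ~ Om x -> S x = 0.
  by move=> nx; rewrite /S P0// big1 ?addr0// => i _; exact: dG0.
have SE x : S x = \sum_i (partial i phi x + phi x * F i x) ^+ 2 +
    phi x ^+ 2 * \sum_i (partial i (F i) x - F i x ^+ 2).
  rewrite /S mulr_sumr -!big_split /=; apply: eq_bigr => i _; rewrite /dG;
    ring.
have Sge x : Om x -> w x * `|phi x| ^+ 2 <= S x.
  move=> Ox; rewrite SE real_normK ?num_real// mulrC.
  rewrite -[leLHS]add0r lerD//; first by apply: sumr_ge0 => i _;
    exact: sqr_ge0.
  by rewrite ler_wpM2l ?sqr_ge0 ?wle.
have Sge0 x : 0 <= S x.
  have [Ox|/S0->//] := pselect (Om x).
  by apply: le_trans (Sge x Ox); rewrite mulr_ge0 ?sqr_ge0.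
have intS : (\int[lebesgue_rV R N]_x (S x)%:E =
    \int[lebesgue_rV R N]_x (\sum_i partial i phi x ^+ 2)%:E)%E.
  rewrite /S; under eq_integral do rewrite EFinD -[X in (_ + X)%E]sumEFin.
  rewrite integralD//; last first.
    apply: (integrable_sum measurableT _ (h := fun i x => (dG i x)%:E)) => i _.
    exact: idG.
  rewrite (integral_sum measurableT (f := fun i x => (dG i x)%:E))//.
  by rewrite big1 ?adde0 // => i _; exact: intG.
have -> : dirichlet Om (grad phi) = (\int[lebesgue_rV R N]_x (S x)%:E)%E.
  rewrite intS /dirichlet integral_mkcond; apply: eq_integral => x _.
  rewrite patchE; case: ifPn => [_|]; first by rewrite enorm_grad_sqr.
  by move=> /negP nx; rewrite P0// => Ox; apply: nx; rewrite inE.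
have mS : measurable_fun setT (EFin \o S).
  by apply/measurable_EFinP; exact: continuous_measurable_rV.
apply: (@le_trans _ _ (\int[lebesgue_rV R N]_(x in Om) (S x)%:E)%E).
  apply: ge0_le_integral => //.
  - by move=> x _; rewrite lee_fin mulr_ge0 ?sqr_ge0.
  - apply/measurable_EFinP; apply: measurable_funTS.
    apply: continuous_measurable_rV; apply: continuous_mulf => //.
    by apply: continuous_mulf => x; apply: continuous_comp; try exact: cphi;
      exact: norm_continuous.
  - exact: measurable_funTS.
apply: ge0_subset_integral => //.
by move=> x _; rewrite lee_fin.
Qed.

(** * From test functions to the Dirichlet space *)

(** The difference of the two sides is d (a - b / d)^2. *)
Lemma sqr_add_le_young (R : realFieldType) (a b d : R) : 0 < d ->
  (a + b) ^+ 2 <= (1 + d) * a ^+ 2 + (1 + d^-1) * b ^+ 2.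
Proof.
move=> d0.
have -> : (1 + d) * a ^+ 2 + (1 + d^-1) * b ^+ 2 =
  (a + b) ^+ 2 + d * (a - d^-1 * b) ^+ 2 by field; rewrite gt_eqF.
by rewrite lerDl mulr_ge0 ?sqr_ge0// ltW.
Qed.

Lemma integral_le_lincomb (R : realType) d (T : measurableType d)
    (mu : {measure set T -> \bar R}) (D : set T) (f g h : T -> R) (p q : R) :
  measurable D -> 0 <= p -> 0 <= q ->
  measurable_fun D f -> measurable_fun D g -> measurable_fun D h ->
  (forall x, D x -> 0 <= f x) -> (forall x, D x -> 0 <= g x) ->
  (forall x, D x -> 0 <= h x) ->
  (forall x, D x -> f x <= p * g x + q * h x) ->
  (\int[mu]_(x in D) (f x)%:E <=
   p%:E * \int[mu]_(x in D) (g x)%:E + q%:E * \int[mu]_(x in D) (h x)%:E)%E.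
Proof.
move=> mD p0 q0 mf mg mh f0 g0 h0 fgh.
have ZE k (F : T -> R) : 0 <= k -> measurable_fun D F ->
    (forall x, D x -> 0 <= F x) ->
    (k%:E * \int[mu]_(x in D) (F x)%:E = \int[mu]_(x in D) (k * F x)%:E)%E.
  move=> k0 mF F0; rewrite -ge0_integralZl//; first exact/measurable_EFinP.
have mZ k (F : T -> R) : measurable_fun D F ->
    measurable_fun D (fun x => k * F x).
  by move=> mF; apply: measurable_funM => //; exact: measurable_cst.
rewrite !ZE// -ge0_integralD//.
- apply: ge0_le_integral => //.
  + exact/measurable_EFinP.
  + by apply: emeasurable_funD; apply/measurable_EFinP; exact: mZ.
- by move=> x Dx; rewrite lee_fin mulr_ge0// g0.
- by apply/measurable_EFinP; exact: mZ.
- by move=> x Dx; rewrite lee_fin mulr_ge0// h0.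
- by apply/measurable_EFinP; exact: mZ.
Qed.

Lemma enormBC (R : realType) N (a b : 'rV[R]_N) :
  enorm (a - b) = enorm (b - a).
Proof.
by congr Num.sqrt; apply: eq_bigr => i _; rewrite !mxE -sqrrN opprB.
Qed.

Lemma le_enorm_young (R : realType) N (a b : 'rV[R]_N) (d : R) : 0 < d ->
  enorm a ^+ 2 <= (1 + d) * enorm b ^+ 2 + (1 + d^-1) * enorm (a - b) ^+ 2.
Proof.
move=> d0; rewrite !enorm_sqr !mulr_sumr -big_split /=; apply: ler_sum => i _.
rewrite !mxE; have := sqr_add_le_young (b ord0 i) (a ord0 i - b ord0 i) d0.
by rewrite [b ord0 i + _]addrC subrK.
Qed.

Lemma measurable_enorm_sqr (R : realType) N d (T : measurableType d)
    (D : set T) (g : T -> 'rV[R]_N) :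
  measurable_fun D g -> measurable_fun D (fun x => enorm (g x) ^+ 2).
Proof.
move=> mg; rewrite (_ : (fun x => _) = fun x => \sum_i (g x) ord0 i ^+ 2).
  apply: measurable_sum => i; apply: measurable_funX.
  exact: (measurableT_comp (measurable_rV_coord i) mg).
by apply/funext => x; exact: enorm_sqr.
Qed.

Lemma measurable_grad (R : realType) N (f : 'rV[R]_N -> R) :
  (forall i, continuous (partial i f)) -> measurable_fun setT (grad f).
Proof.
move=> cf; apply: measurable_fun_rV => i.
rewrite (_ : _ \o _ = partial i f); first exact: continuous_measurable_rV.
by apply/funext => x /=; rewrite /rV_coord mxE.
Qed.

Lemma dirichlet_ge0 (R : realType) N (Om : set 'rV[R]_N) g :
  (0 <= dirichlet Om g)%E.
Proof. by apply: integral_ge0 => x _; rewrite lee_fin sqr_ge0. Qed.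

Lemma test_dirichlet_fin (R : realType) N (Om : set 'rV[R]_N) phi :
  open Om -> bounded_set Om -> test_function Om phi ->
  (dirichlet Om (grad phi) < +oo)%E.
Proof.
move=> oOm /bounded_sub_cbox[M OmM] tphi.
have cpphi i := test_continuous_partial tphi (i := i).
have cP : continuous (fun x => \sum_i partial i phi x ^+ 2).
  by apply: continuous_sumf => i; exact: continuous_mulf.
have := integrable_continuous_cbox (M := M) cP.
have P0 x : ~ cbox M x -> \sum_i partial i phi x ^+ 2 = 0.
  move=> nx; apply: big1 => i _.
  by rewrite (test_partial_out tphi) ?expr0n// => /OmM.
move=> /(_ P0) iP.
have {}iP := integrableS measurableT (open_measurable_rV oOm)
  (@subsetT _ _) iP.
rewrite (le_lt_trans _ (integrable_lty _ iP))//;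
  last exact: open_measurable_rV.
by apply: le_trans (lexx _); rewrite le_eqVlt; apply/orP; left; apply/eqP;
  apply: eq_integral => x _; rewrite enorm_grad_sqr.
Qed.

Section D12_limit.
Variables (R : realType) (N : nat) (Om : set 'rV[R]_N).
Variables (u : 'rV[R]_N -> R) (g : 'rV[R]_N -> 'rV[R]_N).
Hypotheses (oOm : open Om) (bOm : bounded_set Om) (Du : D12 Om u g).

Lemma D12_approx (e : R) : 0 < e -> exists phi,
  [/\ test_function Om phi,
    (\int[lebesgue_rV R N]_(x in Om) (`|phi x - u x| ^+ 2)%:E <= e%:E)%E &
    (dirichlet Om (fun x => (grad phi x - g x)%R) <= e%:E)%E].
Proof.
move=> e0; have [_ _ [phi [tphi c1 c2]]] := Du.
have small (f : nat -> \bar R) : f k @[k --> \oo] --> 0%E ->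
    \forall k \near \oo, (f k <= e%:E)%E.
  move=> /(_ [set y | (y < e%:E)%E]) h.
  have : nbhs (0%E : \bar R) [set y | (y < e%:E)%E].
    exact: (@nbhs_open_ereal_lt _ 0 (fun=> e)).
  move=> /h H; have {}H : \forall k \near \oo, (f k < e%:E)%E by exact: H.
  by apply: filterS H => k /ltW.
have [k [H1 H2]] : exists k,
    (\int[lebesgue_rV R N]_(x in Om) (`|phi k x - u x| ^+ 2)%:E <= e%:E)%E /\
    (dirichlet Om (fun x => (grad (phi k) x - g x)%R) <= e%:E)%E.
  by apply: (@filter_ex _ \oo); apply: filterI; exact: small.
by exists (phi k).
Qed.

Let mOm := open_measurable_rV oOm.

Let mu_ : measurable_fun Om u. Proof. by have [] := Du. Qed.
Let mg_ : measurable_fun Om g. Proof. by have [] := Du. Qed.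

Let mgrad phi : test_function Om phi -> measurable_fun Om (grad phi).
Proof.
move=> tphi; apply: measurable_funTS; apply: measurable_grad => i.
exact: (test_continuous_partial tphi (i := i)).
Qed.

Let mgradB phi : test_function Om phi ->
  measurable_fun Om (fun x => enorm (grad phi x - g x) ^+ 2).
Proof.
move=> tphi.
rewrite (_ : (fun x => _) =
  fun x => \sum_i (grad phi x ord0 i - g x ord0 i) ^+ 2).
  apply: measurable_sum => i; apply: measurable_funX; apply: measurable_funB.
    exact: (measurableT_comp (measurable_rV_coord i) (mgrad tphi)).
  exact: (measurableT_comp (measurable_rV_coord i) mg_).
by apply/funext => x; rewrite enorm_sqr; apply: eq_bigr => i _; rewrite !mxE.
Qed.

(** Needed to exclude a quotient of the form oo / oo, whose value in \bar R is
    0. *)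
Lemma D12_dirichlet_lty : (dirichlet Om g < +oo)%E.
Proof.
have [phi [tphi _ H]] := D12_approx ltr01.
apply: (@le_lt_trans _ _ ((1 + 1)%:E * dirichlet Om (grad phi) +
   (1 + 1^-1)%:E * dirichlet Om (fun x => (grad phi x - g x)%R))%E);
     last first.
  apply: lte_add_pinfty; apply: lte_mul_pinfty => //.
  - exact: test_dirichlet_fin.
  - exact: le_lt_trans H (ltry _).
apply: integral_le_lincomb => //.
- exact: measurable_enorm_sqr.
- by apply: measurable_enorm_sqr; exact: mgrad.
- exact: mgradB.
- by move=> x _; exact: sqr_ge0.
- by move=> x _; exact: sqr_ge0.
- by move=> x _; exact: sqr_ge0.
- by move=> x _; have := le_enorm_young (g x) (grad phi x) (@ltr01 R);
    rewrite (enormBC (g x)).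
Qed.

(** Since w is bounded, both sides are continuous along the approximation of u
    by test functions.  The continuity is obtained from Young's inequality
    with a parameter d rather than from the triangle inequality, which avoids
    square roots of extended reals; the factors 1 + d disappear as d -> 0. *)
Lemma weighted_hardy_D12 (w : 'rV[R]_N -> R) (K : R) :
  0 <= K -> measurable_fun Om w -> (forall x, Om x -> 0 <= w x <= K) ->
  (forall phi, test_function Om phi ->
    (\int[lebesgue_rV R N]_(x in Om) (w x * `|phi x| ^+ 2)%:E <=
      dirichlet Om (grad phi))%E) ->
  (\int[lebesgue_rV R N]_(x in Om) (w x * `|u x| ^+ 2)%:E <=
      dirichlet Om g)%E.
Proof.
move=> K0 mw wK tineq.
set I := (X in (X <= _)%E).
have main (d : R) : 0 < d ->
    (I <= ((1 + d) ^+ 2)%:E * dirichlet Om g + d%:E)%E.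
  move=> d0.
  have d1 : 0 < 1 + d by rewrite addr_gt0.
  have di : 0 < 1 + d^-1 by rewrite addr_gt0 ?invr_gt0.
  (* The value for which the two error terms add up to d exactly. *)
  pose e := d / ((1 + d^-1) * (K + (1 + d))).
  have e0 : 0 < e by rewrite divr_gt0// mulr_gt0// ltr_wpDl.
  have [phi [tphi H1 H2]] := D12_approx e0.
  have cphi := test_continuous tphi.
  have mphi : measurable_fun Om phi.
    by apply: measurable_funTS; exact: continuous_measurable_rV.
  have mB : measurable_fun Om (fun x => `|phi x - u x| ^+ 2).
    apply: measurable_funX; apply: measurableT_comp => //.
    exact: measurable_funB.
  have A1 : (I <= (1 + d)%:E *
      \int[lebesgue_rV R N]_(x in Om) (w x * `|phi x| ^+ 2)%:E +
      ((1 + d^-1) * K)%:E *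
      \int[lebesgue_rV R N]_(x in Om) (`|phi x - u x| ^+ 2)%:E)%E.
    apply: integral_le_lincomb => //.
    - exact: ltW.
    - by rewrite mulr_ge0// ltW.
    - apply: measurable_funM => //; apply: measurable_funX.
      exact: measurableT_comp.
    - apply: measurable_funM => //; apply: measurable_funX.
      exact: measurableT_comp.
    - by move=> x /wK /andP[w0 _]; rewrite mulr_ge0 ?sqr_ge0.
    - by move=> x /wK /andP[w0 _]; rewrite mulr_ge0 ?sqr_ge0.
    - move=> x /wK /andP[w0 wk].
      have := sqr_add_le_young (phi x) (u x - phi x) d0.
      rewrite addrC subrK !real_normK ?num_real// => Hx.
      apply: (@le_trans _ _ (w x * ((1 + d) * phi x ^+ 2 +
         (1 + d^-1) * (u x - phi x) ^+ 2))); first by rewrite ler_wpM2l.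
      rewrite mulrDr mulrCA lerD2l -[u x - phi x]opprB sqrrN mulrA.
      by rewrite ler_wpM2r ?sqr_ge0// mulrC ler_wpM2l// ltW.
  have A2 : (dirichlet Om (grad phi) <= (1 + d)%:E * dirichlet Om g +
      (1 + d^-1)%:E * dirichlet Om (fun x => (grad phi x - g x)%R))%E.
    apply: integral_le_lincomb => //.
    - exact: ltW.
    - exact: ltW.
    - by apply: measurable_enorm_sqr; exact: mgrad.
    - exact: measurable_enorm_sqr.
    - exact: mgradB.
    - by move=> x _; exact: sqr_ge0.
    - by move=> x _; exact: sqr_ge0.
    - by move=> x _; exact: sqr_ge0.
    - by move=> x _; exact: le_enorm_young.
  have Gfin : dirichlet Om g \is a fin_num.
    by rewrite ge0_fin_numE ?dirichlet_ge0 ?D12_dirichlet_lty.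
  apply: (le_trans A1).
  apply: (@le_trans _ _ ((1 + d)%:E * ((1 + d)%:E * dirichlet Om g +
      (1 + d^-1)%:E * e%:E) + ((1 + d^-1) * K)%:E * e%:E)%E).
    apply: leeD; apply: lee_wpmul2l => //.
    - by rewrite lee_fin ltW.
    - apply: (le_trans (tineq _ tphi)); apply: (le_trans A2).
      by apply: leeD => //; apply: lee_wpmul2l => //; rewrite lee_fin ltW.
    - by rewrite lee_fin mulr_ge0// ltW.
  rewrite -(fineK Gfin) -!EFinM -!EFinD lee_fin /e.
  rewrite le_eqVlt; apply/orP; left; apply/eqP; field.
  by rewrite [d + 1]addrC !gt_eqF//= ltr_wpDl.
have Gfin : dirichlet Om g \is a fin_num.
  by rewrite ge0_fin_numE ?dirichlet_ge0 ?D12_dirichlet_lty.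
have G0 : 0 <= fine (dirichlet Om g) by rewrite fine_ge0 ?dirichlet_ge0.
apply/lee_addgt0Pr => e e0.
set b := fine _ in G0.
(* For d <= 1, (1 + d)^2 b + d <= b + d (3 b + 1). *)
pose d := Num.min 1 (e / (3 * b + 1)).
have b1 : 0 < 3 * b + 1 by rewrite ltr_wpDl// mulr_ge0.
have d0 : 0 < d by rewrite lt_min ltr01 divr_gt0.
have d1 : d <= 1 by rewrite ge_min lexx.
have d2 : d * (3 * b + 1) <= e by rewrite -ler_pdivlMr// ge_min lexx orbT.
apply: (le_trans (main d d0)).
rewrite -(fineK Gfin) -/b -EFinM -!EFinD lee_fin.
have : d * (d * b) <= 1 * (d * b) by rewrite ler_wpM2r// mulr_ge0// ltW.
by nra.
Qed.
End D12_limit.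

(** * The multipolar field *)

Section poles.
Variables (R : realType) (N : nat).
Implicit Types (a x : 'rV[R]_N) (e : R).

Lemma is_derive_coord (i k : 'I_N) x :
  is_derive x (delta_mx ord0 i) (fun y : 'rV[R]_N => y ord0 k) (k == i)%:R.
Proof.
have HL (h : R) :
    (h *: delta_mx ord0 i + x) ord0 k = h *: (k == i)%:R + x ord0 k.
  by rewrite !mxE.
exact/(@is_derive_affine R 'rV[R]_N R R (fun y => y ord0 k) id x _ _ _ HL).
Qed.

(** |x - a|^2 as a polynomial in the coordinates, the form in which it is
    differentiated. *)
Definition sqdist a x : R := \sum_k (x ord0 k - a ord0 k) ^+ 2.

Lemma sqdistE a x : sqdist a x = enorm (x - a) ^+ 2.
Proof. by rewrite enorm_sqr; apply: eq_bigr => i _; rewrite !mxE. Qed.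

Lemma sqdist_ge0 a x : 0 <= sqdist a x.
Proof. by apply: sumr_ge0 => i _; exact: sqr_ge0. Qed.

Lemma sqdist_gt0 a x : x != a -> 0 < sqdist a x.
Proof.
move=> xa; rewrite lt_neqAle sqdist_ge0 andbT eq_sym.
apply: contra xa; rewrite psumr_eq0; last by move=> i _; exact: sqr_ge0.
move=> /allP h; apply/eqP/rowP => i.
by have := h i (mem_index_enum _); rewrite sqrf_eq0 subr_eq0 => /eqP.
Qed.

Lemma is_derive_sqdist a x i :
  is_derive x (delta_mx ord0 i) (sqdist a) (2 * (x ord0 i - a ord0 i)).
Proof.
have D k : is_derive x (delta_mx ord0 i)
    (fun y : 'rV[R]_N => y ord0 k - a ord0 k) (k == i)%:R.
  rewrite -[X in is_derive _ _ _ X]addr0; apply: is_derive_addf.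
  exact: is_derive_coord.
have := is_derive_sumf (fun k => is_derive_mulf (D k) (D k)).
rewrite (bigD1 i)//= big1 => [|k ki]; last by rewrite (negPf ki) !mulr0 addr0.
rewrite addr0 eqxx !mulr1 -mulr2n mulr_natl; apply.
Qed.

Lemma continuous_coordB a i : continuous (fun x => x ord0 i - a ord0 i).
Proof.
by apply: continuous_addf; [exact: coord_continuous|exact: cst_continuous].
Qed.

Lemma continuous_sqdist a : continuous (sqdist a).
Proof.
apply: continuous_sumf => k.
by apply: continuous_mulf; exact: continuous_coordB.
Qed.

Lemma is_derive_inv (t : R) : t != 0 ->
  is_derive t 1 (@GRing.inv R) (- t ^- 2).
Proof.
move=> t0; have := @is_deriveV R id t 1 1 t0 (is_derive_id _ _).
by rewrite [_ *: _]mulr1.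
Qed.

Lemma is_derive_inv_sqdist a x e i : 0 < e ->
  is_derive x (delta_mx ord0 i) (fun y => (sqdist a y + e)^-1)
    (- (sqdist a x + e) ^- 2 * (2 * (x ord0 i - a ord0 i))).
Proof.
move=> e0.
have D : is_derive x (delta_mx ord0 i) (fun y => sqdist a y + e)
    (2 * (x ord0 i - a ord0 i)).
  rewrite -[X in is_derive _ _ _ X]addr0; apply: is_derive_addf.
  exact: is_derive_sqdist.
apply: (is_derive_chain D); apply: is_derive_inv.
by rewrite gt_eqF// ltr_wpDl// sqdist_ge0.
Qed.

Lemma continuous_inv_sqdist a e : 0 < e ->
  continuous (fun x => (sqdist a x + e)^-1).
Proof.
move=> e0 x; have h0 : sqdist a x + e != 0.
  by rewrite gt_eqF// ltr_wpDl// sqdist_ge0.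
have c : continuous (fun y => sqdist a y + e).
  by apply: continuous_addf; [exact: continuous_sqdist|exact: cst_continuous].
exact: (cvgV h0 (c x)).
Qed.

End poles.

Section pointwise.
Variables (R : realType) (N n : nat).
Variables (y : 'I_n -> 'I_N -> R) (p : 'I_n -> R) (e D d0 : R).
Let Y j := \sum_i y j i ^+ 2.
Hypotheses (e0 : 0 <= e) (D0 : 0 < D) (d00 : 0 <= d0).
Hypotheses (p0 : forall j, 0 < p j) (pY : forall j, p j * (Y j + e) = 1).
Hypotheses (pD : forall j, D^-1 <= p j).
Hypotheses (yd : forall j k, j != k -> d0 <= \sum_i (y j i - y k i) ^+ 2).
Hypothesis n2 : (2 <= n)%N.

(** In this section y j is x - a_j and p j is 1 / (|x - a_j|^2 + e); the
    right-hand side is the divergence of \sum_j p_j y_j, in which the term of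
    index j is N p_j - 2 p_j (p_j |y_j|^2) with p_j |y_j|^2 <= 1. *)
Lemma polar_field_div :
  (N%:R - 2) * (\sum_j p j) <=
  \sum_i \sum_j (y j i * (- p j ^+ 2 * (2 * y j i)) + p j).
Proof.
rewrite exchange_big /= mulr_sumr; apply: ler_sum => j _.
rewrite big_split /= sumr_const card_ord -mulr_natr.
have -> : \sum_(i < N) y j i * (- p j ^+ 2 * (2 * y j i)) =
    - (2 * p j * (p j * Y j)).
  rewrite /Y !mulr_sumr -sumrN; apply: eq_bigr => i _; ring.
have h := pY j; rewrite mulrDr in h.
have h1 : p j * Y j <= 1 by rewrite -h lerDl mulr_ge0// ltW.
have : 2 * p j * (p j * Y j) <= 2 * p j * 1.
  by rewrite ler_wpM2l// mulr_ge0// ltW.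
by lra.
Qed.

(** Expand the square and polarize: p_j p_k <y_j, y_k> is at most
    (p_j + p_k) / 2 - p_j p_k |y_j - y_k|^2 / 2.  The sum of the first terms is
    n \sum_j p_j.  In the second ones, for each j some k <> j contributes at
    least p_j d0 / (2 D). *)
Lemma polar_field_sqr :
  \sum_i (\sum_j y j i * p j) ^+ 2 <= (n%:R - d0 / (2 * D)) * \sum_j p j.
Proof.
pose d j k := \sum_i (y j i - y k i) ^+ 2.
have -> : \sum_i (\sum_j y j i * p j) ^+ 2 =
    \sum_j \sum_k p j * p k * \sum_i y j i * y k i.
  under eq_bigr do rewrite expr2 big_distrlr /=.
  rewrite exchange_big /=; apply: eq_bigr => j _.
  rewrite exchange_big /=; apply: eq_bigr => k _.
  by rewrite mulr_sumr; apply: eq_bigr => i _; ring.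
have ineq j k : p j * p k * (\sum_i y j i * y k i) <=
    2^-1 * (p j + p k) - 2^-1 * (p j * (p k * d j k)).
  have E : \sum_i y j i * y k i = 2^-1 * (Y j + Y k - d j k).
    by rewrite /Y /d -big_split -sumrB mulr_sumr /=; apply: eq_bigr => i _;
      field.
  have h1 := pY j; have h2 := pY k.
  have pp : 0 <= e * (p j * p k) by rewrite mulr_ge0// mulr_ge0// ltW.
  have -> : p j * p k * (\sum_i y j i * y k i) =
    2^-1 * (p k * (p j * (Y j + e)) + p j * (p k * (Y k + e))) -
    2^-1 * (p j * (p k * d j k)) - e * (p j * p k) by rewrite E; field.
  by rewrite h1 h2; lra.
have far j : D^-1 * d0 <= \sum_k p k * d j k.
  have [k jk] : exists k, j != k.
    case: (n) n2 j => [|[|m]]// _ j.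
    have [->|j0] := eqVneq j ord0; last by exists ord0.
    by exists ord_max.
  rewrite (bigD1 k)//= -[leLHS]addr0 lerD//; last first.
    apply: sumr_ge0 => l _; rewrite mulr_ge0//; first exact: ltW.
    by apply: sumr_ge0 => i _; exact: sqr_ge0.
  by rewrite ler_pM// ?invr_ge0 ?(ltW D0)//; exact: yd.
apply: (@le_trans _ _ (\sum_j (2^-1 * (n%:R * p j + \sum_k p k) -
    2^-1 * (p j * (D^-1 * d0))))).
  apply: ler_sum => j _; apply: le_trans (ler_sum _ (fun k _ => ineq j k)) _.
  rewrite sumrB -!mulr_sumr big_split /= sumr_const card_ord
    -[p j *+ n]mulr_natl.
  by rewrite lerD2l lerN2 ler_wpM2l// ler_wpM2l// ltW.
rewrite sumrB -mulr_sumr big_split /= sumr_const card_ord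
  -[(\sum_i p i) *+ n]mulr_natl.
rewrite -!mulr_sumr -mulr_suml le_eqVlt; apply/orP; left; apply/eqP.
by field; rewrite gt_eqF.
Qed.

End pointwise.

Section multipolar.
Variables (R : realType) (N n : nat) (a : 'I_n -> 'rV[R]_N).
Implicit Types (x : 'rV[R]_N) (e : R).

Definition polar_field e (i : 'I_N) x : R :=
  \sum_j (x ord0 i - a j ord0 i) * (sqdist (a j) x + e)^-1.

(** A regularization of V_* that is continuous, bounded, and increases to V_*
    at every point as e decreases to 0, poles included: the factor
    |x - a_j|^2 makes the j-th term vanish at a_j, in accordance with the
    convention that the j-th term of Vstar is 0 there. *)
Definition Vreg e x : R :=
  \sum_j sqdist (a j) x * (sqdist (a j) x + e)^-1 * (sqdist (a j) x + e)^-1.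

Lemma VstarE x : Vstar a x = \sum_j (sqdist (a j) x)^-1.
Proof. by apply: eq_bigr => j _; rewrite sqdistE. Qed.

Lemma sqdist_addr_gt0 j e x : 0 < e -> 0 < sqdist (a j) x + e.
Proof. by move=> e0; rewrite ltr_wpDl// sqdist_ge0. Qed.

Lemma continuous_polar_field e i : 0 < e -> continuous (polar_field e i).
Proof.
move=> e0; apply: continuous_sumf => j; apply: continuous_mulf.
  exact: continuous_coordB.
exact: continuous_inv_sqdist.
Qed.

Lemma continuous_Vreg e : 0 < e -> continuous (Vreg e).
Proof.
move=> e0; apply: continuous_sumf => j.
apply: continuous_mulf; last exact: continuous_inv_sqdist.
by apply: continuous_mulf;
  [exact: continuous_sqdist|exact: continuous_inv_sqdist].
Qed.

Lemma Vreg_ge0 e x : 0 < e -> 0 <= Vreg e x.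
Proof.
move=> e0; apply: sumr_ge0 => j _.
by rewrite !mulr_ge0 ?sqdist_ge0// invr_ge0 ltW// sqdist_addr_gt0.
Qed.

Lemma Vreg_le e x : 0 < e -> Vreg e x <= \sum_j (sqdist (a j) x + e)^-1.
Proof.
move=> e0; apply: ler_sum => j _.
have h := sqdist_addr_gt0 j x e0.
rewrite -[leRHS]mul1r ler_wpM2r ?invr_ge0 ?(ltW h)//.
by rewrite ler_pdivrMr// mul1r lerDl ltW.
Qed.

Lemma Vreg_bound e x : 0 < e -> Vreg e x <= n%:R * e^-1.
Proof.
move=> e0; apply: le_trans (Vreg_le x e0) _.
rewrite mulr_natl -[n in leRHS]card_ord -sumr_const; apply: ler_sum => j _.
by rewrite lef_pV2 ?posrE ?sqdist_addr_gt0// lerDr sqdist_ge0.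
Qed.

Lemma Vreg_homo e1 e2 x : 0 < e1 -> e1 <= e2 -> Vreg e2 x <= Vreg e1 x.
Proof.
move=> e10 e12; have e20 := lt_le_trans e10 e12.
apply: ler_sum => j _; rewrite -!mulrA ler_wpM2l ?sqdist_ge0//.
have h1 := sqdist_addr_gt0 j x e10; have h2 := sqdist_addr_gt0 j x e20.
by rewrite ler_pM ?invr_ge0 ?(ltW h2)// lef_pV2 ?posrE// lerD2l.
Qed.

Lemma cvg_Vreg x : Vreg (harmonic k) x @[k --> \oo] --> Vstar a x.
Proof.
rewrite VstarE; apply: cvg_big => [|j _]; first exact: add_continuous.
have [->|s0] := eqVneq (sqdist (a j) x) 0.
  by under eq_fun do rewrite !mul0r; rewrite invr0; exact: cvg_cst.
have c : sqdist (a j) x + harmonic k @[k --> \oo] --> sqdist (a j) x.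
  rewrite -[X in _ --> X]addr0; apply: cvgD; first exact: cvg_cst.
  exact: cvg_harmonic.
have ci : (sqdist (a j) x + harmonic k)^-1 @[k --> \oo] -->
    (sqdist (a j) x)^-1.
  exact: (cvgV s0 c).
have -> : (sqdist (a j) x)^-1 =
    sqdist (a j) x * (sqdist (a j) x)^-1 * (sqdist (a j) x)^-1.
  by rewrite divff// mul1r.
exact: (cvgM (cvgM (cvg_cst _) ci) ci).
Qed.

Lemma is_derive_polar_field e i x : 0 < e ->
  is_derive x (delta_mx ord0 i) (polar_field e i)
   (\sum_j ((x ord0 i - a j ord0 i) *
      (- (sqdist (a j) x + e)^-1 ^+ 2 * (2 * (x ord0 i - a j ord0 i))) +
      (sqdist (a j) x + e)^-1)).
Proof.
move=> e0; apply: is_derive_sumf => j.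
have D : is_derive x (delta_mx ord0 i)
    (fun y : 'rV[R]_N => y ord0 i - a j ord0 i) 1.
  rewrite -[X in is_derive _ _ _ X]addr0; apply: is_derive_addf.
  by have := is_derive_coord i i x; rewrite eqxx.
have := is_derive_mulf D (is_derive_inv_sqdist (a j) x i e0).
by rewrite mulr1 exprVn.
Qed.

Lemma min_sqdist : injective a ->
  exists2 d0, 0 < d0 & forall j k, j != k -> d0 <= sqdist (a j) (a k).
Proof.
move=> inja; exists (\big[Num.min/1]_(q : 'I_n * 'I_n | q.1 != q.2)
    sqdist (a q.1) (a q.2)).
  apply: lt_bigmin => // -[j k] /= jk; apply: sqdist_gt0.
  by apply: contra jk => /eqP /inja ->.
move=> j k jk.
exact: (@bigmin_le_cond _ _ _ 1 (j, k) _ (fun q => sqdist (a q.1) (a q.2))).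
Qed.

Lemma bounded_sqdist (Om : set 'rV[R]_N) : bounded_set Om ->
  (forall j, Om (a j)) ->
  exists2 D, 0 < D & forall x j, Om x -> sqdist (a j) x <= D.
Proof.
move=> /bounded_sub_cbox[M OmM] Oa.
exists (N%:R * (2 * M) ^+ 2 + 1);
  first by rewrite ltr_wpDl// mulr_ge0 ?sqr_ge0.
move=> x j /OmM xM; have aM := OmM _ (Oa j).
apply: (@le_trans _ _ (\sum_(k < N) (2 * M) ^+ 2)); last first.
  by rewrite sumr_const card_ord -[leLHS]mulr_natl lerDl.
apply: ler_sum => k _; have := xM k; have := aM k; rewrite !in_itv /=.
move=> /andP[h1 h2] /andP[h3 h4].
rewrite -subr_ge0 subr_sqr mulr_ge0//; lra.
Qed.

End multipolar.

(** * The strict lower bound *)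

Section lower_bound.
Variables (R : realType) (N n : nat).
Variables (a : 'I_n -> 'rV[R]_N) (Om : set 'rV[R]_N).
Hypotheses (N3 : (3 <= N)%N) (n2 : (2 <= n)%N) (oOm : open Om)
  (bOm : bounded_set Om) (inja : injective a)
  (Oa : forall j, Om (a j)).

Let alpha : R := (N%:R - 2) / (2 * n%:R).

(** The constant is C = alpha (N - 2) - alpha^2 (n - d0 / (2 D)), where d0
    bounds the squared distances between poles from below and D bounds
    |x - a_j|^2 + e from above.  The choice alpha = (N - 2) / (2 n) maximizes
    alpha (N - 2) - alpha^2 n, so that C is (N - 2)^2 / (4 n) plus the positive
    gap alpha^2 d0 / (2 D). *)
Lemma hardy_multipolar_test : exists2 C : R, (N%:R - 2) ^+ 2 / (4 * n%:R) < C &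
  forall e phi, 0 < e <= 1 -> test_function Om phi ->
  (\int[lebesgue_rV R N]_(x in Om) (C * Vreg a e x * `|phi x| ^+ 2)%:E <=
    dirichlet Om (grad phi))%E.
Proof.
have [d0 d00 d0a] := min_sqdist inja.
have [D0 D00 D0a] := bounded_sqdist bOm Oa.
pose D := D0 + 1.
have D1 : 0 < D by rewrite addr_gt0.
pose C := alpha * (N%:R - 2) - alpha ^+ 2 * (n%:R - d0 / (2 * D)).
have n0 : 0 < n%:R :> R by rewrite ltr0n (leq_trans _ n2).
have N20 : 0 < N%:R - 2 :> R by rewrite subr_gt0 ltr_nat.
have al0 : 0 < alpha by rewrite divr_gt0// mulr_gt0.
have CE : C = (N%:R - 2) ^+ 2 / (4 * n%:R) + alpha ^+ 2 * (d0 / (2 * D)).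
  by rewrite /C /alpha; field; rewrite !gt_eqF.
have gap : 0 < alpha ^+ 2 * (d0 / (2 * D)).
  by rewrite mulr_gt0 ?exprn_gt0// divr_gt0// mulr_gt0.
have C0 : 0 <= C.
  by rewrite CE addr_ge0 ?(ltW gap)// divr_ge0 ?sqr_ge0// mulr_ge0// ltW.
exists C; first by rewrite CE ltrDl.
move=> e phi /andP[e0 e1] tphi.
have dE i x : partial i (fun y => alpha * polar_field a e i y) x =
    alpha * \sum_j ((x ord0 i - a j ord0 i) *
      (- (sqdist (a j) x + e)^-1 ^+ 2 * (2 * (x ord0 i - a j ord0 i))) +
      (sqdist (a j) x + e)^-1).
  have := is_derive_mulf (is_derive_cst alpha x _)
    (is_derive_polar_field a i x e0).
  by move=> H; rewrite /partial derive_val mulr0 addr0.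
apply: (hardy_vector_field
  (F := fun i y => alpha * polar_field a e i y)) => //.
- move=> i; apply: continuous_mulf; first exact: cst_continuous.
  exact: continuous_polar_field.
- move=> i x.
  by have [] := is_derive_mulf (is_derive_cst alpha x _)
    (is_derive_polar_field a i x e0).
- move=> i; rewrite (_ : partial _ _ =
    fun x => alpha * \sum_j ((x ord0 i - a j ord0 i) *
      (- ((sqdist (a j) x + e)^-1 * (sqdist (a j) x + e)^-1) *
        (2 * (x ord0 i - a j ord0 i))) +
      (sqdist (a j) x + e)^-1)); last by apply/funext => x; rewrite dE.
  apply: continuous_mulf; first exact: cst_continuous.
  apply: continuous_sumf => j.
  have cc := @continuous_coordB R N (a j) i.
  have ci := @continuous_inv_sqdist R N (a j) e e0.
  apply: continuous_addf => //; apply: continuous_mulf => //.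
  apply: continuous_mulf; last by apply: continuous_mulf => //;
    exact: cst_continuous.
  by apply: continuous_oppf; exact: continuous_mulf.
- by apply: continuous_mulf; [exact: cst_continuous|exact: continuous_Vreg].
- by move=> x; rewrite mulr_ge0// Vreg_ge0.
move=> x Ox.
pose y j i := x ord0 i - a j ord0 i.
pose p j := (sqdist (a j) x + e)^-1.
have p0 j : 0 < p j by rewrite invr_gt0 sqdist_addr_gt0.
have pY j : p j * (\sum_i y j i ^+ 2 + e) = 1.
  by rewrite mulVf// gt_eqF// sqdist_addr_gt0.
have pD j : D^-1 <= p j.
  by rewrite lef_pV2 ?posrE ?sqdist_addr_gt0// lerD// D0a.
have yd j k : j != k -> d0 <= \sum_i (y j i - y k i) ^+ 2.
  move=> jk; rewrite (_ : \sum_i _ = sqdist (a j) (a k)) ?d0a//.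
  by apply: eq_bigr => i _; rewrite /y; ring.
have H1 := polar_field_div (ltW e0) p0 pY.
have H2 := polar_field_sqr (ltW e0) D1 (ltW d00) p0 pY pD yd n2.
rewrite sumrB (eq_bigr _ (fun i _ => dE i x)) -mulr_sumr.
have -> : \sum_i (alpha * polar_field a e i x) ^+ 2 =
    alpha ^+ 2 * \sum_i (\sum_j y j i * p j) ^+ 2.
  by rewrite mulr_sumr; apply: eq_bigr => i _; rewrite exprMn.
apply: (@le_trans _ _ (C * \sum_j p j)); first by rewrite ler_wpM2l// Vreg_le.
have -> : C * (\sum_j p j) = alpha * ((N%:R - 2) * \sum_j p j) -
    alpha ^+ 2 * ((n%:R - d0 / (2 * D)) * \sum_j p j) by rewrite /C; ring.
by rewrite lerB// ler_wpM2l ?sqr_ge0// ltW.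
Qed.

Lemma measurable_Vstar (E : set 'rV[R]_N) : measurable_fun E (Vstar a).
Proof.
apply: (@measurable_fun_cvg _ _ _ _ (fun k => Vreg a (harmonic k))) => [k|x _].
  apply: measurable_funTS; apply: continuous_measurable_rV.
  exact/continuous_Vreg/harmonic_gt0.
exact: cvg_Vreg.
Qed.

Lemma hardy_multipolar_D12 : exists2 C : R, (N%:R - 2) ^+ 2 / (4 * n%:R) < C &
  forall u g, D12 Om u g ->
  (C%:E * \int[lebesgue_rV R N]_(x in Om) (Vstar a x * `|u x| ^+ 2)%:E <=
    dirichlet Om g)%E.
Proof.
have [C hC HC] := hardy_multipolar_test; exists C => // u g Du.
have C0 : 0 <= C.
  apply/ltW/(le_lt_trans _ hC).
  by rewrite divr_ge0 ?sqr_ge0// mulr_ge0.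
have mOm := open_measurable_rV oOm.
have [mu_ _ _] := Du.
have mu2 : measurable_fun Om (fun x => `|u x| ^+ 2).
  by apply: measurable_funX; exact: measurableT_comp.
have h0 k : 0 < harmonic k :> R by exact: harmonic_gt0.
have h1 k : harmonic k <= 1 :> R by rewrite /= invf_le1// ler1n.
pose f k x := (C * Vreg a (harmonic k) x * `|u x| ^+ 2)%:E.
have mV k : measurable_fun Om (fun x => C * Vreg a (harmonic k) x).
  apply: measurable_funM; first exact: measurable_cst.
  by apply: measurable_funTS; apply: continuous_measurable_rV;
    exact: continuous_Vreg.
have f_le k : (\int[lebesgue_rV R N]_(x in Om) f k x <= dirichlet Om g)%E.
  apply: (@weighted_hardy_D12 _ _ _ _ _ oOm bOm Du _
    (C * (n%:R * (harmonic k)^-1))).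
  - by rewrite mulr_ge0// mulr_ge0// invr_ge0 ltW.
  - exact: mV.
  - move=> x _; rewrite mulr_ge0 ?Vreg_ge0//=.
    by rewrite ler_wpM2l// Vreg_bound.
  - by move=> phi tphi; apply: HC => //; rewrite h0 h1.
have mf k : measurable_fun Om (f k).
  by apply/measurable_EFinP; apply: measurable_funM.
have f0 k x : Om x -> (0 <= f k x)%E.
  by move=> _; rewrite lee_fin mulr_ge0 ?sqr_ge0// mulr_ge0// Vreg_ge0.
have fh x : Om x -> {homo f^~ x : k m / (k <= m)%N >-> (k <= m)%E}.
  move=> _ k m km; rewrite lee_fin ler_wpM2r ?sqr_ge0// ler_wpM2l//.
  by apply: Vreg_homo => //=; rewrite lef_pV2 ?posrE// ler_nat.
have := monotone_convergence (lebesgue_rV R N) mOm mf f0 fh.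
have -> : (\int[lebesgue_rV R N]_(x in Om) limn (f^~ x) =
  C%:E * \int[lebesgue_rV R N]_(x in Om) (Vstar a x * `|u x| ^+ 2)%:E)%E.
  rewrite -ge0_integralZl//.
  - apply: eq_integral => x _; apply/cvg_lim => //.
    rewrite -EFinM mulrA; apply: cvg_EFin; first exact: nearW.
    apply: cvgM; last exact: cvg_cst.
    by apply: cvgM; [exact: cvg_cst|exact: cvg_Vreg].
  - by apply/measurable_EFinP; apply: measurable_funM => //;
    exact: measurable_Vstar.
  - move=> x _; rewrite lee_fin mulr_ge0 ?sqr_ge0// VstarE sumr_ge0// => j _.
    by rewrite invr_ge0 sqdist_ge0.
move=> ->; apply: lime_le; last exact: nearW.
apply: ereal_nondecreasing_is_cvgn => k m km.
by apply: ge0_le_integral => // x Ox; [exact: f0|exact: fh].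
Qed.

End lower_bound.

(** At a pole, the term of any other pole is positive. *)
Lemma Vstar_gt0 (R : realType) N n (a : 'I_n -> 'rV[R]_N) x :
  (2 <= n)%N -> injective a -> 0 < Vstar a x.
Proof.
move=> n2 inja.
have [j xj] : exists j, x != a j.
  case: n n2 a inja => [|[|n]]// _ a inja.
  have [->|x0] := eqVneq x (a ord0); last by exists ord0.
  by exists ord_max; apply/eqP => /inja.
rewrite VstarE (bigD1 j)//= ltr_wpDr ?invr_gt0 ?sqdist_gt0//.
by apply: sumr_ge0 => k _; rewrite invr_ge0 sqdist_ge0.
Qed.

Lemma le_div_ereal (R : realFieldType) (c : R) (x y : \bar R) :
  0 < c -> (0 < y)%E -> (x < +oo)%E -> (c%:E * y <= x)%E -> (c%:E <= x / y)%E.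
Proof.
move=> c0; case: y => [y||] //; last first.
  by rewrite gt0_muley ?lte_fin// => _ xoo; rewrite leye_eq => /eqP xE;
    rewrite xE in xoo.
rewrite lte_fin => y0; case: x => [x||] // _.
rewrite -EFinM lee_fin => cy.
by rewrite inver gt_eqF// -EFinM lee_fin ler_pdivlMr.
Qed.

(** The constant C is independent of u, so the strict inequality survives the
    infimum. *)
Lemma hardy_mu_gt (R : realType) N n (a : 'I_n -> 'rV[R]_N)
    (Om : set 'rV[R]_N) :
  (3 <= N)%N -> (2 <= n)%N -> open Om -> bounded_set Om -> injective a ->
  (forall j, Om (a j)) ->
  (((N%:R - 2) ^+ 2 / (4 * n%:R))%:E < hardy_mu a Om)%E.
Proof.
move=> N3 n2 oOm bOm inja Oa.
have [C hC HC] := hardy_multipolar_D12 N3 n2 oOm bOm inja Oa.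
have C0 : 0 < C.
  by apply: le_lt_trans hC; rewrite divr_ge0 ?sqr_ge0// mulr_ge0.
apply: (@lt_le_trans _ _ C%:E); first by rewrite lte_fin.
apply: le_ereal_inf_tmp => _ [u [g [Du u0 ->]]].
have mOm := open_measurable_rV oOm.
have [mu_ _ _] := Du.
have f0 x : 0 <= Vstar a x * `|u x| ^+ 2.
  by rewrite mulr_ge0 ?sqr_ge0// ltW// Vstar_gt0.
apply: le_div_ereal => //; last exact: HC.
  rewrite lt_neqAle integral_ge0 ?andbT; last by move=> x _; rewrite lee_fin.
  apply/negP => /eqP I0; apply: u0.
  have mf : measurable_fun Om (fun x => (Vstar a x * `|u x| ^+ 2)%:E).
    apply/measurable_EFinP; apply: measurable_funM;
      first exact: measurable_Vstar.
    by apply: measurable_funX; exact: measurableT_comp.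
  have /(ae_eq_integral_abs _ mOm mf) : (\int[lebesgue_rV R N]_(x in Om)
      `|(Vstar a x * `|u x| ^+ 2)%:E| = 0)%E.
    by rewrite I0; apply: eq_integral => x _; rewrite gee0_abs// lee_fin.
  apply: filterS => x /[apply] /= -[] /eqP.
  by rewrite mulf_eq0 gt_eqF ?Vstar_gt0//= sqrf_eq0 normr_eq0 => /eqP.
exact: D12_dirichlet_lty Du.
Qed.

(** * Elementary smooth functions and a flat cutoff *)

Lemma is_derive_expf (R : realType) (V : normedModType R)
    (f : V -> R) k x v df :
  is_derive x v f df ->
  is_derive x v (fun y => f y ^+ k) (k%:R * f x ^+ k.-1 * df).
Proof.
move=> Hf; elim: k => [|k IH].
  by rewrite !mul0r; under eq_fun do rewrite expr0; exact: is_derive_cst.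
under eq_fun do rewrite exprS.
rewrite (_ : k.+1%:R * _ * _ =
    f x * (k%:R * f x ^+ k.-1 * df) + f x ^+ k * df).
  exact: is_derive_mulf.
by case: k {IH} => [|k] /=; rewrite ?exprS ?expr0; ring.
Qed.

Section flat.
Variable R : realType.

(** The flat functions t^(- k) exp (- 1 / t), extended by 0 to t <= 0.  The
    exponent k makes the family closed under differentiation, up to linear
    combinations. *)
Definition theta (k : nat) (t : R) : R :=
  if 0 < t then t^-1 ^+ k * expR (- t^-1) else 0.

Lemma theta_ge0 k t : 0 <= theta k t.
Proof.
rewrite /theta; case: ifPn => // t0.
by rewrite mulr_ge0 ?expR_ge0// exprn_ge0// invr_ge0 ltW.
Qed.

(** With y = 1 / t this is y^(k + 2) <= (k + 2)! exp y.  A quadratic bound is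
    what is needed for the derivative at 0 to vanish. *)
Lemma theta_le_sqr k t : theta k t <= (k.+2)`!%:R * t ^+ 2.
Proof.
rewrite /theta; case: ifPn => [t0|_]; last by rewrite mulr_ge0 ?sqr_ge0.
have y0 : 0 < t^-1 by rewrite invr_gt0.
have := expR_ge1Dxn k.+1 (ltW y0) => h.
have f0 : 0 < (k.+2)`!%:R :> R by rewrite ltr0n fact_gt0.
have {}h : t^-1 ^+ k.+2 <= (k.+2)`!%:R * expR t^-1.
  rewrite mulrC -ler_pdivrMr//; apply: le_trans h; lra.
rewrite expRN ler_pdivrMr ?expR_gt0//.
apply: (@le_trans _ _ (t ^+ 2 * t^-1 ^+ k.+2)).
  by rewrite -[k.+2]addn2 exprD mulrCA -exprMn divff ?gt_eqF// expr1n mulr1.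
by rewrite [leRHS]mulrAC [leRHS]mulrC ler_wpM2l ?sqr_ge0.
Qed.

(** The difference quotient at 0 is at most C |h| in absolute value. *)
Lemma is_derive_flat (f : R -> R) C : (forall t, `|f t| <= C * t ^+ 2) ->
  is_derive (0 : R) 1 f 0.
Proof.
move=> fC.
have f0 : f 0 = 0.
  by apply/eqP; rewrite -normr_le0; have := fC 0; rewrite expr0n mulr0.
have C0 : 0 <= C by have := fC 1; rewrite expr1n mulr1; apply: le_trans.
have c : (h^-1 *: ((f \o shift 0) (h *: (1 : R)) - f 0) @[h --> 0^'])
    --> (0 : R).
  apply/cvgrPdist_lt => e e0; near=> h.
  have h0 : h != 0 by near: h; exact: nbhs_dnbhs_neq.
  have hs : `|h| < e / (C + 1).
    near: h; apply: dnbhs0_lt; rewrite divr_gt0// ltr_wpDl//.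
  rewrite /= f0 subr0 addr0 sub0r normrN [h *: 1]mulr1 normrZ normfV.
  have nh : 0 < `|h| by rewrite normr_gt0.
  rewrite -ltr_pdivlMl ?invr_gt0// invrK.
  apply: (le_lt_trans (fC h)); rewrite -real_normK ?num_real//
    expr2 mulrA mulrC.
  rewrite ltr_pM2l// mulrC.
  rewrite ltr_pdivlMr ?ltr_wpDl// in hs.
  by apply: le_lt_trans hs; rewrite ler_wpM2l// lerDl.
by split; [apply/cvg_ex; exists 0|exact: cvg_lim].
Unshelve. all: by end_near. Qed.

Lemma is_derive_theta k (t : R) :
  is_derive t 1 (theta k) (- k%:R * theta k.+1 t + theta k.+2 t).
Proof.
have [t0|t0|t0] := ltgtP t 0.
- have -> : - k%:R * theta k.+1 t + theta k.+2 t = 0.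
    by rewrite /theta ltNge (ltW t0) /= mulr0 addr0.
  apply: (@near_eq_is_derive _ _ _ (cst 0)).
  near=> s; rewrite /theta ltNge ltW//=.
  near: s; exact: lt_nbhsl.
- have -> : - k%:R * theta k.+1 t + theta k.+2 t =
    t^-1 ^+ k * (expR (- t^-1) * t ^- 2) +
    expR (- t^-1) * (k%:R * t^-1 ^+ k.-1 * - t ^- 2).
    rewrite /theta t0 -exprVn; move: (t^-1) (expR _) => y z.
    by case: k => [|k] /=; rewrite ?exprS ?expr0; ring.
  apply: (@near_eq_is_derive _ _ _ (fun s : R => s^-1 ^+ k * expR (- s^-1))).
    near=> s; rewrite /theta ifT//; near: s; exact: lt_nbhsr.
  have D : is_derive t 1 (@GRing.inv R) (- t ^- 2).
    by apply: is_derive_inv; rewrite gt_eqF.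
  have DN : is_derive t 1 (fun s : R => - s^-1) (t ^- 2).
    by rewrite -[X in is_derive _ _ _ X]opprK; exact: is_deriveN.
  apply: is_derive_mulf.
    exact: is_derive_expf.
rewrite t0.
have -> : - k%:R * theta k.+1 0 + theta k.+2 0 = 0.
  by rewrite /theta ltxx mulr0 addr0.
apply: (@is_derive_flat _ (k.+2)`!%:R) => s.
by rewrite ger0_norm ?theta_ge0// theta_le_sqr.
Unshelve. all: by end_near. Qed.

End flat.

Section elementary.
Variables (R : realType) (N : nat).

(** A class of functions on R^N in which each function has all its partial
    derivatives in the class, so that membership proves smoothness by mere
    closure.  The outer function of a composition is given with a family F of
    functions of one variable closed under differentiation on a domain D that
    contains the values of the inner function; this covers both real powers of
    positive functions and the flat functions theta k. *)
Inductive elementary : ('rV[R]_N -> R) -> Prop :=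
| elementary_cst c : elementary (cst c)
| elementary_coord i : elementary (fun x => x ord0 i)
| elementary_add f g : elementary f -> elementary g ->
    elementary (fun x => f x + g x)
| elementary_mul f g : elementary f -> elementary g ->
    elementary (fun x => f x * g x)
| elementary_comp (F : set (R -> R)) (D : set R) h f : F h ->
    (forall h1, F h1 -> exists2 h2, F h2 &
      forall t, D t -> is_derive t 1 h1 (h2 t)) ->
    elementary f -> (forall x, D (f x)) -> elementary (h \o f).

Lemma elementary_continuous f : elementary f -> continuous f.
Proof.
elim => [c|i|g h _ cg _ ch|g h _ cg _ ch|F D h g Fh HF _ cg Dg].
- exact: cst_continuous.
- exact: coord_continuous.
- exact: continuous_addf.
- exact: continuous_mulf.
- move=> x; apply: continuous_comp; first exact: cg.
  have [h2 _ dh] := HF h Fh.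
  apply: differentiable_continuous; apply/derivable1_diffP.
  by have [] := dh _ (Dg x).
Qed.

Lemma elementary_derive f i : elementary f -> exists2 f', elementary f' &
  forall x, is_derive x (delta_mx ord0 i) f (f' x).
Proof.
elim => [c|k|g h _ [g' eg dg] _ [h' eh dh]|g h eg0 [g' eg dg] eh0 [h' eh dh]
  |F D h g Fh HF eg0 [g' eg dg] Dg].
- by exists (cst 0); [exact: elementary_cst|move=> x; exact: is_derive_cst].
- exists (cst (k == i)%:R); first exact: elementary_cst.
  by move=> x; exact: is_derive_coord.
- exists (fun x => g' x + h' x); first exact: elementary_add.
  by move=> x; exact: is_derive_addf.
- exists (fun x => g x * h' x + h x * g' x).
    by apply: elementary_add; exact: elementary_mul.
  by move=> x; exact: is_derive_mulf.
- have [h2 Fh2 dh] := HF h Fh.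
  exists (fun x => (h2 \o g) x * g' x).
    by apply: elementary_mul => //; exact: (elementary_comp Fh2 HF).
  by move=> x; apply: is_derive_chain => //; exact: dh.
Qed.

Lemma elementary_smooth f : elementary f -> smooth f.
Proof.
move=> ef s.
have es : elementary (foldr (@partial R N) f s).
  elim: s => [//|i s IH] /=.
  have [f' ef' df'] := elementary_derive i IH.
  rewrite (_ : partial i _ = f')//.
  by apply/funext => x; rewrite /partial; exact: derive_val.
split; first exact: elementary_continuous.
by move=> i x; have [f' _ /(_ x)[]] := elementary_derive i es.
Qed.

Lemma elementary_sqdist a : elementary (sqdist a).
Proof.
rewrite /sqdist; elim: (index_enum _) => [|i s IH].
  by under eq_fun do rewrite big_nil; exact: elementary_cst.
under eq_fun do rewrite big_cons expr2.
apply: elementary_add => //.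
have e : elementary (fun x : 'rV[R]_N => x ord0 i - a ord0 i).
  by apply: elementary_add; [exact: elementary_coord|exact: elementary_cst].
exact: elementary_mul.
Qed.

Lemma elementary_powR f b : elementary f -> (forall x, 0 < f x) ->
  elementary (fun x => f x `^ b).
Proof.
move=> ef f0.
pose F : set (R -> R) := [set h | exists c p, h = fun t => c * t `^ p].
apply: (@elementary_comp F [set t | 0 < t] (fun t => t `^ b)) => //.
  by exists 1, b; apply/funext => t; rewrite mul1r.
move=> _ [c [p ->]]; exists (fun t => c * p * t `^ (p - 1)).
  by exists (c * p), (p - 1).
move=> t /= t0.
have := is_derive_mulf (is_derive_cst c t 1) (is_derive1_powR p t0).
by rewrite mulr0 addr0 mulrA.
Qed.

Inductive theta_span : (R -> R) -> Prop :=
| theta_span_theta k : theta_span (theta k)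
| theta_span_scale c h : theta_span h -> theta_span (fun t => c * h t)
| theta_span_add h1 h2 : theta_span h1 -> theta_span h2 ->
    theta_span (fun t => h1 t + h2 t).

Lemma elementary_theta f k : elementary f ->
  elementary (fun x => theta k (f x)).
Proof.
move=> ef.
apply: (@elementary_comp theta_span setT (theta k)) => //.
  exact: theta_span_theta.
move=> h; elim=> [j|c h1 _ [h2 sh dh]|h1 h2 _ [g1 s1 d1] _ [g2 s2 d2]].
- exists (fun t => - j%:R * theta j.+1 t + theta j.+2 t).
    apply: theta_span_add; last exact: theta_span_theta.
    by apply: theta_span_scale; exact: theta_span_theta.
  by move=> t _; exact: is_derive_theta.
- exists (fun t => c * h2 t); first exact: theta_span_scale.
  move=> t _; have := is_derive_mulf (is_derive_cst c t 1) (dh t I).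
  by rewrite mulr0 addr0.
- exists (fun t => g1 t + g2 t); first exact: theta_span_add.
  by move=> t _; apply: is_derive_addf; [exact: d1|exact: d2].
Qed.

End elementary.

(** * Trial functions concentrating at one pole *)

Section trial.
Variables (R : realType) (N : nat) (a : 'rV[R]_N) (rho b : R).
Hypotheses (rho0 : 0 < rho) (b0 : 0 <= b).
Implicit Types (x : 'rV[R]_N) (e : R).

(** The virtual minimizer |x - a|^(- 2 b) of the one-pole inequality,
    regularized by e and cut off at |x - a|^2 = rho. *)
Definition trial e x : R :=
  (sqdist a x + e) `^ (- b) * theta 0 (rho - sqdist a x).

(** Up to the factor 4 b^2, the part of |grad trial|^2 in which the cutoff is
    not differentiated.  Its factor |x - a|^2 makes it at most
    |trial|^2 / |x - a|^2 at every point, including x = a, where that quotient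
    is 0. *)
Definition trial_kernel e x : R :=
  sqdist a x *
  ((sqdist a x + e) `^ (- b - 1) * theta 0 (rho - sqdist a x)) ^+ 2.

Let sqdist_addr_gt0 e x : 0 < e -> 0 < sqdist a x + e.
Proof. by move=> e0; rewrite ltr_wpDl// sqdist_ge0. Qed.

Lemma trial_kernel_ge0 e x : 0 <= trial_kernel e x.
Proof. by rewrite mulr_ge0 ?sqdist_ge0 ?sqr_ge0. Qed.

Let elem_shift e : elementary (fun x => sqdist a x + e).
Proof.
by apply: elementary_add; [exact: elementary_sqdist|exact: elementary_cst].
Qed.

Let elem_cut : elementary (fun x => rho - sqdist a x).
Proof.
under eq_fun do rewrite -mulN1r.
apply: elementary_add; first exact: elementary_cst.
by apply: elementary_mul; [exact: elementary_cst|exact: elementary_sqdist].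
Qed.

Lemma elementary_trial e : 0 < e -> elementary (trial e).
Proof.
move=> e0; apply: elementary_mul; last exact: elementary_theta.
by apply: elementary_powR => // x; exact: sqdist_addr_gt0.
Qed.

Lemma continuous_trial_kernel e : 0 < e -> continuous (trial_kernel e).
Proof.
move=> e0; apply: elementary_continuous; apply: elementary_mul.
  exact: elementary_sqdist.
under eq_fun do rewrite expr2.
have h : elementary (fun x => (sqdist a x + e) `^ (- b - 1) *
    theta 0 (rho - sqdist a x)).
  apply: elementary_mul; last exact: elementary_theta.
  by apply: elementary_powR => // x; exact: sqdist_addr_gt0.
exact: elementary_mul.
Qed.

Lemma test_function_trial e (Om : set 'rV[R]_N) : 0 < e -> bounded_set Om ->
  (forall x, sqdist a x <= rho -> Om x) -> test_function Om (trial e).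
Proof.
move=> e0 bOm sub.
have clB : closed [set x | sqdist a x <= rho].
  rewrite (_ : [set x | _] = sqdist a @^-1` [set t | t <= rho]) //.
  apply: closed_comp; last exact: closed_le.
  by move=> x _; exact: continuous_sqdist.
have supp : closure [set x | trial e x != 0] `<=` [set x | sqdist a x <= rho].
  rewrite closureE => x; apply; split => // y /=.
  apply: contra_neqT; rewrite -ltNge => h.
  by rewrite /trial /theta subr_gt0 ltNge (ltW h)/= mulr0.
have subOm : closure [set x | trial e x != 0] `<=` Om by move=> x /supp /sub.
split => //; first exact/elementary_smooth/elementary_trial.
apply: bounded_closed_compact; last exact: closed_closure.
by have [M [Mr HM]] := bOm; exists M; split => // r Mr' y /subOm; exact: HM.
Qed.

Lemma partial_trial e x i : 0 < e -> partial i (trial e) x =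
  - (2 * (x ord0 i - a ord0 i)) *
  (b * ((sqdist a x + e) `^ (- b - 1) * theta 0 (rho - sqdist a x)) +
   (sqdist a x + e) `^ (- b) * theta 2 (rho - sqdist a x)).
Proof.
move=> e0; rewrite /partial.
have Ds := is_derive_sqdist a x i.
have D1 : is_derive x (delta_mx ord0 i) (fun y => sqdist a y + e)
    (2 * (x ord0 i - a ord0 i)).
  by rewrite -[X in is_derive _ _ _ X]addr0; apply: is_derive_addf.
have D2 : is_derive x (delta_mx ord0 i) (fun y => rho - sqdist a y)
    (- (2 * (x ord0 i - a ord0 i))).
  rewrite -[X in is_derive _ _ _ X]add0r; apply: is_derive_addf.
have D3 := is_derive_chain D1 (is_derive1_powR (- b) (sqdist_addr_gt0 x e0)).
have D4 := is_derive_chain D2 (is_derive_theta 0 _).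
have [_] := is_derive_mulf D3 D4; rewrite /trial /= => ->.
by ring.
Qed.

Lemma enorm_grad_trial e x : 0 < e -> enorm (grad (trial e) x) ^+ 2 =
  4 * sqdist a x *
  (b * ((sqdist a x + e) `^ (- b - 1) * theta 0 (rho - sqdist a x)) +
   (sqdist a x + e) `^ (- b) * theta 2 (rho - sqdist a x)) ^+ 2.
Proof.
move=> e0; rewrite enorm_grad_sqr.
under eq_bigr do rewrite partial_trial// exprMn sqrrN exprMn.
by rewrite -mulr_suml -mulr_sumr; congr (_ * _ * _); ring.
Qed.

Lemma powR_neg1 (t : R) : 0 < t -> t `^ (- b) = t * t `^ (- b - 1).
Proof.
move=> t0; have := @powRD _ t (- b - 1) 1.
by rewrite subrK powRr1 ?ltW// (gt_eqF t0)/= implybT => -> //; rewrite mulrC.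
Qed.

Lemma trial_kernel_le e x : 0 < e ->
  trial_kernel e x <= (sqdist a x)^-1 * `|trial e x| ^+ 2.
Proof.
move=> e0; rewrite real_normK ?num_real// /trial /trial_kernel.
have s0 := sqdist_ge0 a x; have se := sqdist_addr_gt0 x e0.
rewrite powR_neg1//; move: s0 se.
move: (sqdist a x) (theta 0 _) => s c s0 se.
move: (_ `^ _) => w.
have [->|sn] := eqVneq s 0; first by rewrite mul0r invr0 mul0r.
have sp : 0 < s by rewrite lt_neqAle eq_sym sn.
rewrite ler_pdivlMl//.
have -> : s * (s * (w * c) ^+ 2) = s ^+ 2 * (w * c) ^+ 2 by ring.
have -> : ((s + e) * w * c) ^+ 2 = (s + e) ^+ 2 * (w * c) ^+ 2 by ring.
rewrite ler_wpM2r ?sqr_ge0//.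
by rewrite ler_sqr ?nnegrE ?(ltW se)// lerDl ltW.
Qed.

Lemma theta2E (t : R) : theta 2 t = t ^- 2 * theta 0 t.
Proof.
rewrite /theta; case: ifP => _; last by rewrite mulr0.
by rewrite expr0 mul1r exprVn.
Qed.

(** The part of |grad trial|^2 in which the cutoff is differentiated.  For
    s + e <= tau it is small compared with the kernel, because it carries an
    additional factor (s + e)^2 while theta 2 (rho - s) is comparable to
    theta 0 (rho - s) away from s = rho; for s + e > tau the function is no
    longer singular, uniformly in e. *)
Lemma trial_remainder (eta : R) : 0 < eta -> exists2 B, 0 <= B &
  forall e x, 0 < e ->
  4 * sqdist a x *
  ((sqdist a x + e) `^ (- b) * theta 2 (rho - sqdist a x)) ^+ 2
  <= eta * trial_kernel e x + B.
Proof.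
move=> eta0.
(* rho / 2 keeps rho - s away from 0; the last bound makes the ratio to the
   kernel, at most 4 (tau (rho / 2)^-2)^2, smaller than eta. *)
pose tau := Num.min (rho / 2) (Num.min 1 (eta * rho ^+ 4 / 64)).
have tau0 : 0 < tau.
  by rewrite !lt_min ltr01 !divr_gt0//= mulr_gt0// exprn_gt0.
have tau1 : tau <= rho / 2 by rewrite ge_min lexx.
have tau2 : tau <= 1 by rewrite !ge_min lexx orbT.
have tau3 : tau <= eta * rho ^+ 4 / 64 by rewrite !ge_min lexx !orbT.
pose W := tau `^ (- b).
exists (4 * rho * (W * (4`!%:R * rho ^+ 2)) ^+ 2).
  by rewrite mulr_ge0 ?sqr_ge0// mulr_ge0// ltW.
move=> e x e0; rewrite /trial_kernel.
have s0 := sqdist_ge0 a x; have se := sqdist_addr_gt0 x e0.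
move: s0 se; move: (sqdist a x) => s s0 se.
have [st|ts] := leP (s + e) tau.
  rewrite -[leLHS]addr0 lerD//; last first.
    by rewrite mulr_ge0 ?sqr_ge0// mulr_ge0// ltW.
  rewrite powR_neg1// theta2E.
  set w := _ `^ _; set c := theta 0 _.
  have t0 : rho / 2 <= rho - s by lra.
  have rp : 0 < rho / 2 by rewrite divr_gt0.
  have h1 : (rho - s) ^- 2 <= (rho / 2) ^- 2.
    rewrite lef_pV2 ?posrE ?exprn_gt0//; last exact: lt_le_trans t0.
    by rewrite ler_sqr ?nnegrE ?(ltW rp)//; apply: ltW; apply: lt_le_trans t0.
  have h2 : (s + e) * (rho - s) ^- 2 <= tau * (rho / 2) ^- 2.
    by rewrite ler_pM// ?(ltW se)// invr_ge0 sqr_ge0.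
  have h3 : ((s + e) * (rho - s) ^- 2) ^+ 2 <= (tau * (rho / 2) ^- 2) ^+ 2.
    by rewrite ler_sqr ?nnegrE ?mulr_ge0 ?invr_ge0 ?sqr_ge0 ?(ltW se)
      ?(ltW tau0).
  have h4 : (tau * (rho / 2) ^- 2) ^+ 2 <= eta / 4.
    have -> : (tau * (rho / 2) ^- 2) ^+ 2 = tau * (tau * (16 / rho ^+ 4)).
      by field; rewrite gt_eqF.
    apply: (@le_trans _ _ (1 * (eta * rho ^+ 4 / 64 * (16 / rho ^+ 4)))).
      have r4 : 0 <= 16 / rho ^+ 4 by rewrite divr_ge0// exprn_ge0// ltW.
      rewrite ler_pM// ?(ltW tau0)//; first by rewrite mulr_ge0// ltW.
      by rewrite ler_wpM2r.
    by rewrite le_eqVlt; apply/orP; left; apply/eqP; field; rewrite gt_eqF.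
  have -> : 4 * s * ((s + e) * w * ((rho - s) ^- 2 * c)) ^+ 2 =
    (4 * ((s + e) * (rho - s) ^- 2) ^+ 2) * (s * (w * c) ^+ 2).
    by ring.
  rewrite ler_wpM2r ?(mulr_ge0 s0 (sqr_ge0 _))//.
  move: (le_trans h3 h4); move: (((s + e) * (rho - s) ^- 2) ^+ 2) => X hX; lra.
rewrite -[leLHS]add0r lerD//.
  by rewrite mulr_ge0 ?(ltW eta0)// mulr_ge0 ?sqr_ge0.
have [rs|sr] := leP rho s.
  rewrite /theta ltNge subr_le0 rs /= mulr0 expr0n mulr0.
  by rewrite mulr_ge0 ?sqr_ge0// mulr_ge0// ltW.
apply: ler_pM;
  [by rewrite mulr_ge0|exact: sqr_ge0|by rewrite ler_wpM2l// ltW|].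
have w0 : 0 <= (s + e) `^ (- b) by exact: powR_ge0.
rewrite ler_sqr ?nnegrE ?mulr_ge0 ?theta_ge0 ?powR_ge0 ?sqr_ge0 ?(ltW rho0)//.
apply: ler_pM; [exact: w0|exact: theta_ge0| | ].
  rewrite /W !powRN lef_pV2 ?posrE ?powR_gt0//.
  by rewrite ge0_ler_powR ?nnegrE ?(ltW tau0) ?(ltW se)// ltW.
apply: (le_trans (theta_le_sqr _ _)); rewrite ler_wpM2l//.
by rewrite ler_sqr ?nnegrE ?(ltW rho0)//; lra.
Qed.

(** Young's inequality separates the two parts of the gradient; its parameter
    is small enough for the first one to cost at most d / 2, and the second one
    is absorbed by trial_remainder for the matching value of eta. *)
Lemma trial_dirichlet_pointwise (d : R) : 0 < d -> exists2 B, 0 <= B &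
  forall e x, 0 < e -> enorm (grad (trial e) x) ^+ 2 <=
    (4 * b ^+ 2 + d) * trial_kernel e x + B.
Proof.
move=> d0.
(* The denominator 4 b^2 + 1 is positive also when b is 0. *)
pose del := d / (4 * b ^+ 2 + 1) / 2.
have k0 : 0 < 4 * b ^+ 2 + 1 by rewrite ltr_wpDl// mulr_ge0 ?sqr_ge0.
have del0 : 0 < del by rewrite !divr_gt0.
have di : 0 < 1 + del^-1 by rewrite addr_gt0 ?invr_gt0.
have eta0 : 0 < d / 2 / (1 + del^-1) by rewrite !divr_gt0.
have [B B0 HB] := trial_remainder eta0.
exists ((1 + del^-1) * B); first by rewrite mulr_ge0// ltW.
move=> e x e0; rewrite enorm_grad_trial//.
have := HB e x e0; have := trial_kernel_ge0 e x; rewrite /trial_kernel.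
move: (sqdist_ge0 a x); move: (sqdist a x) => s s0.
set p := (_ `^ _ * theta 0 _); set q := (_ * theta 2 _) => J0 H.
have Y := sqr_add_le_young (b * p) q del0.
apply: (@le_trans _ _ (4 * s * ((1 + del) * (b * p) ^+ 2 +
  (1 + del^-1) * q ^+ 2))).
  by rewrite ler_wpM2l// mulr_ge0.
have -> : 4 * s * ((1 + del) * (b * p) ^+ 2 + (1 + del^-1) * q ^+ 2) =
  (1 + del) * (4 * b ^+ 2) * (s * p ^+ 2) + (1 + del^-1) *
    (4 * s * q ^+ 2) by ring.
have H2 : (1 + del^-1) * (4 * s * q ^+ 2) <=
    (1 + del^-1) * (d / 2 / (1 + del^-1) * (s * p ^+ 2) + B).
  by rewrite ler_wpM2l// ltW.
have E2 : (1 + del^-1) * (d / 2 / (1 + del^-1) * (s * p ^+ 2) + B) =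
    d / 2 * (s * p ^+ 2) + (1 + del^-1) * B.
  by move: di; move: (1 + del^-1) => k kp; field; rewrite gt_eqF.
have H3 : del * (4 * b ^+ 2) <= d / 2.
  have -> : del * (4 * b ^+ 2) = d / 2 * (4 * b ^+ 2 / (4 * b ^+ 2 + 1)).
    by rewrite /del; field; rewrite gt_eqF.
  rewrite -[leRHS]mulr1 ler_wpM2l ?divr_ge0 ?(ltW d0)//.
  by rewrite ler_pdivrMr// mul1r lerDl.
have H4 : del * (4 * b ^+ 2) * (s * p ^+ 2) <= d / 2 * (s * p ^+ 2).
  by rewrite ler_wpM2r.
rewrite E2 in H2; lra.
Qed.

End trial.

(** * Divergence of the kernel integrals *)

Section cubes.
Variables (R : realType) (N : nat) (a : 'rV[R]_N) (h : R).
Hypothesis h0 : 0 < h.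

Let t (k : nat) : R := h / 2 ^+ k.

Let t_gt0 k : 0 < t k. Proof. by rewrite divr_gt0// exprn_gt0. Qed.

Let tS k : t k = 2 * t k.+1.
Proof. by rewrite /t exprS; field; rewrite expf_neq0//= lt0r_neq0. Qed.

Let t_homo k m : (k <= m)%N -> t m <= t k.
Proof.
move=> km; rewrite /t ler_pM2l// lef_pV2 ?posrE ?exprn_gt0//.
by rewrite ler_weXn2l// ler1n.
Qed.

(** The cubes a + ]h / 2^(k + 1), h / 2^k]^N are pairwise disjoint, have side
    h / 2^(k + 1), and |x - a| is comparable to that side on them. *)
Definition dyadic_cube k : set 'rV[R]_N :=
  [set x | forall i,
    x ord0 i \in `](a ord0 i + h / 2 ^+ k.+1), (a ord0 i + h / 2 ^+ k)]].

Lemma measurable_dyadic_cube k : measurable (dyadic_cube k).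
Proof.
rewrite (_ : dyadic_cube k = \bigcap_(i in [set: 'I_N])
  (@rV_coord R N i @^-1` `](a ord0 i + t k.+1), (a ord0 i + t k)]%classic)).
  apply: fin_bigcap_measurable => // i _.
  by rewrite -[X in measurable X]setTI; exact: measurable_rV_coord.
by apply/seteqP; split=> v H; [move=> i _|move=> i]; exact: H.
Qed.

Lemma lebesgue_dyadic_cube k :
  lebesgue_rV R N (dyadic_cube k) = ((h / 2 ^+ k.+1) ^+ N)%:E.
Proof.
have tkS : t k.+1 < t k by rewrite [t k]tS ltr_pMl// ltr1n.
rewrite (@lebesgue_rV_box R N (fun i => `](a ord0 i + t k.+1),
  (a ord0 i + t k)]%classic))//.
under eq_bigr => i _.
  rewrite lebesgue_measure_itv /= lte_fin ltrD2l tkS -EFinB.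
  rewrite (_ : _ - _ = t k.+1); last by rewrite [t k]tS; ring.
  over.
by rewrite prodEFin prodr_const card_ord.
Qed.

Lemma trivIset_dyadic_cube (D : set nat) : (0 < N)%N -> trivIset D dyadic_cube.
Proof.
move=> N0; suff H k m : (k < m)%N -> dyadic_cube k `&` dyadic_cube m = set0.
  apply/trivIsetP => k m _ _; rewrite neq_ltn => /orP[|] /H //.
  by rewrite setIC.
move=> km; rewrite -subset0 => x [/(_ (Ordinal N0)) + /(_ (Ordinal N0))].
rewrite !in_itv /= => /andP[h1 _] /andP[_ h2].
have := lt_le_trans h1 h2; rewrite ltrD2l ltNge => /negP; apply.
exact: t_homo.
Qed.

Lemma sqdist_dyadic_cube k x : dyadic_cube k x ->
  N%:R * (h / 2 ^+ k.+1) ^+ 2 <= sqdist a x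
    <= 4 * (N%:R * (h / 2 ^+ k.+1) ^+ 2).
Proof.
move=> kx.
have E (c : R) : N%:R * c = \sum_(i < N) c.
  by rewrite sumr_const card_ord mulr_natl.
rewrite (mulrCA 4) !E; apply/andP; split; apply: ler_sum => i _;
  have := kx i; rewrite in_itv /= -!/(t _) [t k]tS => /andP[h1 h2];
  have t0 := t_gt0 k.+1.
  by rewrite ler_sqr ?nnegrE; lra.
have -> : 4 * t k.+1 ^+ 2 = (2 * t k.+1) ^+ 2 by ring.
by rewrite ler_sqr ?nnegrE; lra.
Qed.

(** On the k-th cube, of side tau, the kernel is at least a constant times
    tau^2 (tau^2)^(- 2 b - 2) = tau^(- N), as long as e is at most of order
    tau^2.  Its integral over the cube is then bounded below independently of
    k. *)
Lemma trial_kernel_dyadic_cube rho k e x :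
  (0 < N)%N -> 0 < rho -> 8 * (N%:R * h ^+ 2) <= rho ->
  0 < e <= N%:R * (h / 2 ^+ k.+1) ^+ 2 -> dyadic_cube k x ->
  N%:R * ((8 * N%:R) `^ (- ((N%:R - 2) / 4) - 1) * expR (- (rho / 2)^-1)) ^+ 2
  <= trial_kernel a rho ((N%:R - 2) / 4) e x * (h / 2 ^+ k.+1) ^+ N.
Proof.
move=> N0 rho0 hrho /andP[e0 eN] kx.
have /andP[s1 s2] := sqdist_dyadic_cube kx.
rewrite /trial_kernel; set b := (N%:R - 2) / 4.
have N1 : 1 <= N%:R :> R by rewrite ler1n.
rewrite -!/(t _) in s1 s2 eN *.
have t0 := t_gt0 k.+1; have th : t k.+1 <= h.
  by rewrite /t ler_pdivrMr ?exprn_gt0// ler_peMr ?(ltW h0)// exprn_ege1//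
    ler1n.
move: (t k.+1) t0 th eN s1 s2 => tau t0 th eN s1 s2.
move: (sqdist a x) s1 s2 => s s1 s2.
have q0 : 0 < tau ^+ 2 by rewrite exprn_gt0.
have Nq : 0 < N%:R * tau ^+ 2 by rewrite mulr_gt0// (lt_le_trans _ N1).
have s0 : 0 < s by exact: lt_le_trans s1.
have srho : s <= rho / 2.
  have : N%:R * tau ^+ 2 <= N%:R * h ^+ 2.
    by rewrite ler_wpM2l// ler_sqr ?nnegrE ?(ltW h0) ?(ltW t0).
  by lra.
have b1 : 0 <= b + 1.
  by rewrite /b; lra.
have th0 : expR (- (rho / 2)^-1) <= theta 0 (rho - s).
  rewrite /theta ifT; last by lra.
  rewrite expr0 mul1r ler_expR lerN2 lef_pV2 ?posrE; lra.
have w0 : (8 * N%:R) `^ (- b - 1) * (tau ^+ 2) `^ (- b - 1)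
  <= (s + e) `^ (- b - 1).
  rewrite -powRM ?(ltW q0)//.
  rewrite -opprD !powRN lef_pV2 ?posrE ?powR_gt0//; last 2 first.
    by rewrite mulr_gt0// mulr_gt0// (lt_le_trans _ N1).
    by rewrite addr_gt0.
  by rewrite ge0_ler_powR ?nnegrE//; lra.
(* The exponents match because 4 (b + 1) = N + 2. *)
have wE : ((tau ^+ 2) `^ (- b - 1)) ^+ 2 * tau ^+ N.+2 = 1.
  rewrite -[(_ `^ _) ^+ 2]powR_mulrn ?powR_ge0// -powRrM.
  rewrite -[tau ^+ 2]powR_mulrn ?(ltW t0)// -powRrM.
  rewrite (_ : 2 * ((- b - 1) * 2) = - (N.+2)%:R); last first.
    by rewrite /b -[in RHS]addn2 natrD; field.
  rewrite powRN powR_mulrn ?(ltW t0)// mulVf//.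
  by rewrite expf_neq0// gt_eqF.
set A := (8 * N%:R) `^ _ in w0 *; set E := expR _ in th0 *.
have -> : N%:R * (A * E) ^+ 2 = N%:R * tau ^+ 2 *
   (A * (tau ^+ 2) `^ (- b - 1) * E) ^+ 2 * tau ^+ N.
  rewrite -[LHS]mulr1 -[X in _ * X = _]wE -[N.+2]addn2 exprD; ring.
rewrite ler_wpM2r ?exprn_ge0 ?(ltW t0)//.
have A0 : 0 <= A by exact: powR_ge0.
have E0 : 0 <= E by exact: expR_ge0.
apply: ler_pM => //; [exact: ltW|exact: sqr_ge0|].
rewrite ler_sqr ?nnegrE ?mulr_ge0 ?powR_ge0 ?theta_ge0//.
by apply: ler_pM => //; rewrite mulr_ge0// powR_ge0.
Qed.

End cubes.

Section kernel_integral.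
Variables (R : realType) (N : nat) (a : 'rV[R]_N) (Om : set 'rV[R]_N).
Hypotheses (N3 : (3 <= N)%N) (oOm : open Om).
Let b : R := (N%:R - 2) / 4.

(** Choose e of the order of the square of the side of the K-th cube: each of
    the K first cubes contributes the same constant c. *)
Lemma integral_trial_kernel_unbounded (rho : R) : 0 < rho ->
  (forall x, sqdist a x <= rho -> Om x) ->
  forall M : R, exists2 e, 0 < e &
   (M%:E <= \int[lebesgue_rV R N]_(x in Om) (trial_kernel a rho b e x)%:E)%E.
Proof.
move=> rho0 sub M.
have N0 : (0 < N)%N by rewrite (leq_trans _ N3).
have N0R : 0 < N%:R :> R by rewrite ltr0n.
(* Then |x - a|^2 <= rho / 2 on all the cubes, where theta 0 (rho - |x - a|^2)
   is at least exp (- 2 / rho). *)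
pose h := Num.sqrt (rho / (8 * N%:R)).
have h2 : h ^+ 2 = rho / (8 * N%:R).
  by rewrite sqr_sqrtr// divr_ge0 ?(ltW rho0)// mulr_ge0.
have h0 : 0 < h by rewrite sqrtr_gt0 divr_gt0// mulr_gt0.
have hrho : 8 * (N%:R * h ^+ 2) <= rho.
  rewrite h2 le_eqVlt; apply/orP; left; apply/eqP; field.
  by rewrite gt_eqF.
pose c := N%:R * ((8 * N%:R) `^ (- b - 1) * expR (- (rho / 2)^-1)) ^+ 2.
have c0 : 0 < c.
  by rewrite mulr_gt0// exprn_gt0// mulr_gt0 ?expR_gt0// powR_gt0// mulr_gt0.
pose K := (Num.truncn (`|M| / c)).+1.
have MK : M <= K%:R * c.
  rewrite -ler_pdivrMr//; apply: le_trans (ltW (truncnS_gt _)).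
  by rewrite ler_pM2r ?invr_gt0// ler_norm.
pose e := N%:R * (h / 2 ^+ K) ^+ 2.
have e0 : 0 < e by rewrite mulr_gt0// exprn_gt0// divr_gt0// exprn_gt0.
exists e => //.
have mOm := open_measurable_rV oOm.
have mker (E : set 'rV[R]_N) :
  measurable_fun E (fun x => (trial_kernel a rho b e x)%:E).
  apply/measurable_EFinP; apply: measurable_funTS.
  by apply: continuous_measurable_rV; exact: continuous_trial_kernel.
have ker0 x : (0 <= (trial_kernel a rho b e x)%:E)%E.
  by rewrite lee_fin trial_kernel_ge0.
pose B k := dyadic_cube a h k.
have mB k : measurable (B k) by exact: measurable_dyadic_cube.
pose U := \big[setU/set0]_(k <- iota 0 K) B k.
have mU : measurable U by apply: bigsetU_measurable.
have UOm : U `<=` Om.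
  rewrite /U -bigcup_seq => x [k _ kx]; apply: sub.
  have /andP[_] := sqdist_dyadic_cube h0 kx; move/le_trans; apply.
  apply: le_trans hrho.
  rewrite ler_pM//.
  - by rewrite mulr_ge0 ?sqr_ge0// ltW.
  - by rewrite ler_nat.
  rewrite ler_wpM2l ?(ltW N0R)// ler_sqr ?nnegrE ?(ltW h0)//.
    by rewrite ler_pdivrMr ?exprn_gt0// ler_peMr ?(ltW h0)// exprn_ege1//
      ler1n.
  by rewrite divr_ge0 ?(ltW h0)// exprn_ge0.
apply: (@le_trans _ _ (\int[lebesgue_rV R N]_(x in U)
  (trial_kernel a rho b e x)%:E)%E);
  last exact: ge0_subset_integral.
rewrite /U ge0_integral_bigsetU ?iota_uniq//; last first.
  exact: trivIset_dyadic_cube.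
apply: (@le_trans _ _ (\sum_(k <- iota 0 K) c%:E)%E).
  by rewrite sumEFin big_const_seq count_predT size_iota iter_addr_0 lee_fin
    -mulr_natl.
rewrite !big_seq; apply: lee_sum => k; rewrite mem_iota add0n /= => kK.
have tk0 : 0 < h / 2 ^+ k.+1 by rewrite divr_gt0// exprn_gt0.
have tN0 : 0 < (h / 2 ^+ k.+1) ^+ N by rewrite exprn_gt0.
have -> : c%:E =
    (\int[lebesgue_rV R N]_(x in B k) (c / (h / 2 ^+ k.+1) ^+ N)%:E)%E.
  rewrite integral_cst//.
  transitivity ((c / (h / 2 ^+ k.+1) ^+ N)%:E * ((h / 2 ^+ k.+1) ^+ N)%:E)%E.
    by rewrite -EFinM divfK// gt_eqF.
  by congr (_ * _)%E; rewrite -(lebesgue_dyadic_cube a h0).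
apply: ge0_le_integral => //.
- by move=> x _; rewrite lee_fin divr_ge0 ?ltW.
- move=> x kx; rewrite lee_fin ler_pdivrMr//.
  apply: trial_kernel_dyadic_cube => //; rewrite e0 /e ler_wpM2l ?(ltW N0R)//.
  rewrite ler_sqr ?nnegrE ?(ltW tk0)//;
    last by rewrite divr_ge0 ?(ltW h0)// exprn_ge0.
  by rewrite ler_pM2l// lef_pV2 ?posrE ?exprn_gt0// ler_weXn2l// ler1n.
Qed.

End kernel_integral.

(** * The upper bound *)

Lemma div_le_ereal (R : realFieldType) (c : R) (x y : \bar R) :
  0 <= c -> (0 < y)%E -> (x <= c%:E * y)%E -> (x / y <= c%:E)%E.
Proof.
move=> c0; case: y => [y||] //; last by rewrite invey mule0 lee_fin.
rewrite lte_fin => y0; case: x => [x||] //.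
  by rewrite -EFinM lee_fin inver gt_eqF// -EFinM lee_fin ler_pdivrMr.
by move=> _; rewrite inver gt_eqF// gt0_mulNye ?lte_fin ?invr_gt0// leNye.
Qed.

Lemma open_sqdist_ball (R : realType) N (Om : set 'rV[R]_N) (a : 'rV[R]_N) :
  open Om -> Om a ->
  exists2 rho, 0 < rho & forall x, sqdist a x <= rho -> Om x.
Proof.
move=> oOm Oa.
have /nbhs_ballP[r /= r0 rOm] : nbhs a Om by exact: open_nbhs_nbhs.
exists ((r / 2) ^+ 2); first by rewrite exprn_gt0// divr_gt0.
move=> x xr; apply: rOm; split => // i j; rewrite ord1 /ball /= distrC.
apply: (@le_lt_trans _ _ (r / 2)); last by lra.
rewrite -ler_sqr ?nnegrE ?normr_ge0 ?divr_ge0 ?(ltW r0)//.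
rewrite real_normK ?num_real//; apply: le_trans xr.
rewrite /sqdist (bigD1 j)//= lerDl; apply: sumr_ge0 => k _; exact: sqr_ge0.
Qed.

(** Approximate a test function by itself. *)
Lemma test_D12 (R : realType) N (Om : set 'rV[R]_N) phi :
  test_function Om phi -> D12 Om phi (grad phi).
Proof.
move=> tphi; split.
- apply: measurable_funTS; apply: continuous_measurable_rV.
  exact: test_continuous tphi.
- apply: measurable_funTS; apply: measurable_grad => i.
  exact: (test_continuous_partial tphi (i := i)).
exists (fun=> phi); split => //.
- under eq_fun do under eq_integral do rewrite subrr normr0 expr0n /=.
  by rewrite integral0; exact: cvg_cst.
- rewrite (_ : dirichlet _ _ = 0%E); first exact: cvg_cst.
  apply: integral0_eq => x _; rewrite enorm_sqr big1// => i _.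
  by rewrite !mxE subrr expr0n.
Qed.

Lemma lebesgue_bounded_lty (R : realType) N (Om : set 'rV[R]_N) :
  open Om -> bounded_set Om -> (lebesgue_rV R N Om < +oo)%E.
Proof.
move=> oOm /bounded_sub_cbox[M OmM].
apply: le_lt_trans (lebesgue_cbox_lty N M).
apply: le_measure => //; rewrite inE; last exact: measurable_cbox.
exact: open_measurable_rV.
Qed.

(** Given d, the constant B is fixed first; then e is chosen so small that
    B times the volume of the domain is at most d / 2 times the integral of the
    kernel. *)
Lemma hardy_mu_le (R : realType) N n (a : 'I_n -> 'rV[R]_N)
    (Om : set 'rV[R]_N) :
  (3 <= N)%N -> (0 < n)%N -> open Om -> bounded_set Om ->
  (forall j, Om (a j)) ->
  (hardy_mu a Om <= ((N%:R - 2) ^+ 2 / 4)%:E)%E.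
Proof.
move=> N3 n0 oOm bOm Oa.
have N2 : 0 <= N%:R - 2 :> R by rewrite subr_ge0 ler_nat (leq_trans _ N3).
pose b : R := (N%:R - 2) / 4; have b0 : 0 <= b by rewrite divr_ge0.
have -> : (N%:R - 2) ^+ 2 / 4 = 4 * b ^+ 2 by rewrite /b; field.
pose j := Ordinal n0.
have [rho rho0 sub] := open_sqdist_ball oOm (Oa j).
have mOm := open_measurable_rV oOm.
apply/lee_addgt0Pr => d d0.
have d20 : 0 < d / 2 by rewrite divr_gt0.
have [B B0 HB] := trial_dirichlet_pointwise (a j) rho0 b0 d20.
pose V := fine (lebesgue_rV R N Om).
have Vfin : lebesgue_rV R N Om \is a fin_num.
  by rewrite ge0_fin_numE//; exact: lebesgue_bounded_lty.
have V0 : 0 <= V by rewrite fine_ge0.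
have [e e0 He] := integral_trial_kernel_unbounded N3 oOm rho0 sub
  (B * V / (d / 2) + 1).
pose u := trial (a j) rho b e.
pose ker x := trial_kernel (a j) rho b e x.
have tu : test_function Om u by exact: test_function_trial.
have cu := test_continuous tu.
set I := (\int[_]_(x in _) _)%E in He.
have mker (E : set 'rV[R]_N) : measurable_fun E ker.
  by apply: measurable_funTS; apply: continuous_measurable_rV;
    exact: continuous_trial_kernel.
have Du : (dirichlet Om (grad u) <= (4 * b ^+ 2 + d / 2)%:E * I +
    B%:E * lebesgue_rV R N Om)%E.
  have -> : (B%:E * lebesgue_rV R N Om =
      B%:E * \int[lebesgue_rV R N]_(x in Om) 1%:E)%E.
    by congr (_ * _)%E; rewrite integral_cst// mul1e.
  apply: integral_le_lincomb => //.
  - by rewrite addr_ge0 ?(ltW d20)// mulr_ge0 ?sqr_ge0.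
  - apply: measurable_enorm_sqr; apply: measurable_funTS;
    apply: measurable_grad => i.
    exact: (test_continuous_partial tu (i := i)).
  - by move=> x _; exact: sqr_ge0.
  - by move=> x _; exact: trial_kernel_ge0.
  - by move=> x _; rewrite mulr1; exact: HB.
pose H := (\int[lebesgue_rV R N]_(x in Om) (Vstar a x * `|u x| ^+ 2)%:E)%E.
have mHf : measurable_fun Om (fun x => (Vstar a x * `|u x| ^+ 2)%:E).
  apply/measurable_EFinP; apply: measurable_funM;
    first exact: measurable_Vstar.
  apply: measurable_funX; apply: measurableT_comp => //.
  by apply: measurable_funTS; exact: continuous_measurable_rV.
have Vge x : (sqdist (a j) x)^-1 <= Vstar a x.
  rewrite VstarE (bigD1 j)//= lerDl; apply: sumr_ge0 => k _.
  by rewrite invr_ge0 sqdist_ge0.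
have IH : (I <= H)%E.
  apply: ge0_le_integral => //.
  - by move=> x _; rewrite lee_fin trial_kernel_ge0.
  - exact/measurable_EFinP.
  - move=> x _; rewrite lee_fin.
    apply: (le_trans (trial_kernel_le (a j) rho b x e0)).
    by rewrite ler_wpM2r ?sqr_ge0.
have M1 : 0 < B * V / (d / 2) + 1.
  by rewrite ltr_wpDl// divr_ge0 ?(ltW d20)// mulr_ge0.
have H0 : (0 < H)%E.
  by apply: lt_le_trans IH; apply: lt_le_trans He; rewrite lte_fin.
apply: (@ge_ereal_inf _ _ _).
exists (dirichlet Om (grad u) / H)%E.
  exists u, (grad u); split => //; first exact: test_D12.
  move=> u0; have H00 : H = 0%E.
    rewrite /H (@ge0_ae_eq_integral _ _ _ _ _ _ (cst 0%E)) ?integral0//.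
      move=> x _; rewrite lee_fin mulr_ge0 ?sqr_ge0//.
      by apply: le_trans (Vge x); rewrite invr_ge0 sqdist_ge0.
    apply: filterS u0 => x ux Ox; rewrite ux//=.
    by rewrite normr0 expr0n mulr0.
  by rewrite H00 ltxx in H0.
apply: div_le_ereal => //.
  by rewrite addr_ge0 ?(ltW d0)// mulr_ge0 ?sqr_ge0.
apply: (le_trans Du); apply: (@le_trans _ _ ((4 * b ^+ 2 + d)%:E * I)%E);
  last first.
  apply: lee_wpmul2l => //.
  by rewrite lee_fin addr_ge0 ?(ltW d0)// mulr_ge0 ?sqr_ge0.
have -> : 4 * b ^+ 2 + d = (4 * b ^+ 2 + d / 2) + d / 2 by field.
rewrite [in leRHS]EFinD ge0_muleDl; last 2 first.
  by rewrite lee_fin addr_ge0 ?(ltW d20)// mulr_ge0 ?sqr_ge0.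
  by rewrite lee_fin ltW.
apply: leeD => //.
rewrite -(fineK Vfin) -EFinM -/V.
apply: (@le_trans _ _ ((d / 2)%:E * (B * V / (d / 2) + 1)%:E)%E); last first.
  by apply: lee_wpmul2l => //; rewrite lee_fin ltW.
rewrite -EFinM lee_fin mulrDr mulr1 [_ / (d / 2)]mulrC mulVKf ?gt_eqF//.
by rewrite lerDl ltW.
Qed.

Theorem corollary4p5 (R : realType) (N n : nat) (Omega : set 'rV[R]_N)
    (a : 'I_n -> 'rV[R]_N) :
  (3 <= N)%N -> (2 <= n)%N ->
  open Omega -> connected Omega -> bounded_set Omega ->
  injective a -> (forall i, Omega (a i)) ->
  (((N%:R - 2) ^+ 2 / (4 * n%:R))%:E < hardy_mu a Omega
     <= ((N%:R - 2) ^+ 2 / 4)%:E)%E.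
Proof.
move=> N3 n2 oOm _ bOm inja Oa; apply/andP; split.
  exact: hardy_mu_gt.
by apply: hardy_mu_le => //; exact: leq_trans n2.
Qed.
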